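(* There exists an absolute constant $\kappa>1/100$ such that, for $T,\tau,\hat T$ as below and $0<\theta=\tanh\beta\le3/4$, $$m_\rho\le\frac{\mathrm{cap}_2(\hat T)}{\kappa(1-\theta)/4},$$ where $\mathrm{cap}_2$ is computed with resistances $R_{(u,v)}=\theta^{-2\,\mathrm{dist}(\rho,v)}$.
   Context: $T$ is a finite rooted tree with root $\rho$, leaves $\partial T$, edges $(u,v)$ with $v$ a child of $u$, $T_v$ the subtree of $v$ and its descendants. The Ising Gibbs measure at inverse temperature $\beta$ has density $\propto\exp(\beta\sum_{uv}\sigma(u)\sigma(v))$. For a boundary condition $\tau\in\{\pm1\}^{\partial T}$, $\mu_v^\tau$ is the Gibbs measure on $T_v$ conditioned on agreeing with $\tau$ on $\partial T\cap T_v$. $\hat T$ is a connected subtree of $T\setminus\partial T$ containing $\rho$, $\partial\hat T$ its leaves, $\hat T_v=T_v\cap\hat T$; for $\xi\in\{\pm1\}^{\partial\hat T}$, $\hat\mu_v^\xi$ is the Gibbs measure on $\hat T_v$ conditioned on $\sigma=\xi$ on $\partial\hat T\cap \hat T_v$. $Q_v^{\pm}(\xi)=\mu_v^\tau(\sigma_{\partial\hat T_v}=\xi_{\partial\hat T_v}\mid\sigma(v)=\pm1)$. Define $x_v^\xi=\log\big(\hat\mu_v^\xi(\sigma(v)=1)/\hat\mu_v^\xi(\sigma(v)=-1)\big)$ and $m_v=\int x_v^\xi\,dQ_v^+(\xi)-\int x_v^\xi\,dQ_v^-(\xi)$. $L^2$-capacity: given resistances $R_e>0$, a flow is a nonnegative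 $f$ on edges with $f(u,v)=\sum_{(v,w)}f(v,w)$ whenever $v$ is not a leaf; strength $|f|=\sum_{(\rho,v)}f(\rho,v)$, voltage $V(f)=\max_{w\text{ leaf}}\sum_{e\in\mathcal P(\rho,w)}f(e)R_e$; $\mathrm{cap}_2=\sup\{|f|:V(f)\le1\}$ (the effective conductance between $\rho$ and the leaves). *)

(* Defs.v *)
From Stdlib Require Import Reals List Arith Bool.
Import ListNotations.
Open Scope R_scope.

(* ---------- Finite rooted trees ----------
   Vertices are 0..n-1, the root is 0, and par v is the parent of v
   (for 0 < v < n), with par v < v.  Every finite rooted tree admits such
   a labelling (e.g. BFS order).  Edges are (par w, w) for 0 < w < n; we
   index an edge by its child endpoint w. *)

Definition tree_ok (n : nat) (par : nat -> nat) : Prop :=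
  forall v, (0 < v)%nat -> (v < n)%nat -> (par v < v)%nat.

Definition verts (n : nat) : list nat := seq 0 n.

Fixpoint ancs (par : nat -> nat) (fuel w : nat) : list nat :=
  match fuel with
  | O => [w]
  | S f => if Nat.eqb w 0 then [0%nat] else w :: ancs par f (par w)
  end.

Definition path_to_root (n : nat) (par : nat -> nat) (w : nat) : list nat :=
  ancs par n w.

Definition dist_root (n : nat) (par : nat -> nat) (w : nat) : nat :=
  pred (length (path_to_root n par w)).

Definition inT (n : nat) (par : nat -> nat) (v w : nat) : bool :=
  Nat.ltb w n && existsb (Nat.eqb v) (path_to_root n par w).

Definition leafT (n : nat) (par : nat -> nat) (v : nat) : bool :=
  Nat.ltb v n && negb (Nat.eqb v 0) &&
  forallb (fun w => negb (Nat.eqb (par w) v)) (seq 1 (n - 1)).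

(* hat T given by its vertex indicator H; its leaves: non-root vertices of
   hat T without children in hat T *)
Definition leafH (n : nat) (par : nat -> nat) (H : nat -> bool) (v : nat) : bool :=
  H v && negb (Nat.eqb v 0) &&
  forallb (fun w => negb (H w && Nat.eqb (par w) v)) (seq 1 (n - 1)).

Definition hat_subtree (n : nat) (par : nat -> nat) (H : nat -> bool) : Prop :=
  H 0%nat = true /\
  (forall v, H v = true -> (v < n)%nat /\ leafT n par v = false) /\
  (forall v, H v = true -> (0 < v)%nat -> H (par v) = true).

Definition spin (b : bool) : R := if b then 1 else -1.

Definition upd (s : nat -> bool) (v : nat) (b : bool) : nat -> bool :=
  fun w => if Nat.eqb w v then b else s w.

Fixpoint sumcfg (vs : list nat) (s : nat -> bool) (f : (nat -> bool) -> R) : R :=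
  match vs with
  | [] => f s
  | v :: vs' => sumcfg vs' (upd s v true) f + sumcfg vs' (upd s v false) f
  end.

Definition ind (b : bool) : R := if b then 1 else 0.

(* Ising energy sum_{uv} sigma(u) sigma(v) over the edges of the subtree
   of v of the tree with vertex set P (P = everything for T, P = H for hat T) *)
Definition energy (n : nat) (par : nat -> nat) (P : nat -> bool) (v : nat)
  (sg : nat -> bool) : R :=
  fold_right Rplus 0
    (map (fun w => spin (sg (par w)) * spin (sg w))
       (filter (fun w => negb (Nat.eqb w v) && inT n par v w && P w)
          (seq 1 (n - 1)))).

Definition gibbs (n : nat) (par : nat -> nat) (beta : R) (P fixed : nat -> bool)
  (b : nat -> bool) (v : nat) (f : (nat -> bool) -> R) : R :=
  let free := filter (fun w => inT n par v w && P w && negb (fixed w)) (verts n) in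
  sumcfg free b (fun sg => exp (beta * energy n par P v sg) * f sg) /
  sumcfg free b (fun sg => exp (beta * energy n par P v sg)).

Definition muT n par beta (tau : nat -> bool) v f :=
  gibbs n par beta (fun _ => true) (leafT n par) tau v f.

Definition muH n par beta (H : nat -> bool) (xi : nat -> bool) v f :=
  gibbs n par beta H (leafH n par H) xi v f.

Definition bdH_v n par H v : list nat :=
  filter (fun w => leafH n par H w && inT n par v w) (verts n).

Definition Qv n par beta tau H v (s : bool) (xi : nat -> bool) : R :=
  muT n par beta tau v
    (fun sg => ind (forallb (fun w => Bool.eqb (sg w) (xi w)) (bdH_v n par H v))
               * ind (Bool.eqb (sg v) s)) /
  muT n par beta tau v (fun sg => ind (Bool.eqb (sg v) s)).

Definition xv n par beta H v (xi : nat -> bool) : R :=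
  ln (muH n par beta H xi v (fun sg => ind (sg v)) /
      muH n par beta H xi v (fun sg => ind (negb (sg v)))).

Definition mv n par beta tau H v : R :=
  sumcfg (bdH_v n par H v) (fun _ => true)
    (fun xi => xv n par beta H v xi * Qv n par beta tau H v true xi) -
  sumcfg (bdH_v n par H v) (fun _ => true)
    (fun xi => xv n par beta H v xi * Qv n par beta tau H v false xi).

(* an edge (par w, w) of hat T is indexed by w, with H w and w <> 0 *)
Definition edgesH n (H : nat -> bool) : list nat :=
  filter (fun w => H w) (seq 1 (n - 1)).

Definition childrenH n par H (v : nat) : list nat :=
  filter (fun w => Nat.eqb (par w) v) (edgesH n H).

Definition is_flow n par H (f : nat -> R) : Prop :=
  (forall w, In w (edgesH n H) -> 0 <= f w) /\
  (forall w, In w (edgesH n H) -> leafH n par H w = false ->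
     f w = fold_right Rplus 0 (map f (childrenH n par H w))).

Definition strength n par H (f : nat -> R) : R :=
  fold_right Rplus 0 (map f (childrenH n par H 0%nat)).

Definition path_sum n par (Res f : nat -> R) (w : nat) : R :=
  fold_right Rplus 0
    (map (fun e => f e * Res e)
       (filter (fun e => negb (Nat.eqb e 0)) (path_to_root n par w))).

Definition voltage n par H (Res f : nat -> R) : R :=
  fold_right Rmax 0
    (map (path_sum n par Res f) (filter (leafH n par H) (verts n))).

Definition is_cap2 n par H (Res : nat -> R) (c : R) : Prop :=
  is_lub (fun r => exists f, is_flow n par H f /\ voltage n par H Res f <= 1
                            /\ r = strength n par H f) c.

Definition resist n par (theta : R) (w : nat) : R :=
  / (theta ^ (2 * dist_root n par w)).

(* Main.v *)
Require Import Defs.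
From Stdlib Require Import Reals List Arith Bool Lia Lra Permutation FunctionalExtensionality.
From Coquelicot Require Import Coquelicot.
Import ListNotations Defs.
Open Scope R_scope.

(** Given the root spin [s], the spins of T under the Gibbs measure form a
    tree-indexed Markov chain whose transitions have influence at most [theta].
    With [f(x) = 2 artanh(theta tanh(x/2))] the log-ratios satisfy
    [x_v = sum_w f(x_w)], so [m_v <= theta * sum_w (Q_w^+ - Q_w^-) f(x_w)].  The boundary
    condition enters [Q^+] and [Q^-] as an external field on hat T, and
    [log (dQ^+/dQ^-)] obeys, up to constants, the same recursion with shifted
    arguments.  We bound [M_v], the largest of [(Q_v^+ - Q_v^-) X] over all such
    statistics [X]; it controls both [m_v] and the symmetrised relative entropy
    of [Q_v^+] and [Q_v^-], hence [M_v] is at least a constant times the squared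
    total variation distance.  Since [f' <= theta], with a definite gain away
    from a window of width of order [sqrt M] around 0, and since [Q^+] dominates
    [Q^-], the gain is lost only on a bounded part of [X], which total variation
    controls.  This gives
    [M_v <= sum_w theta^2 M_w / (1 + k M_w)] with [k = kappa (1 - theta) / 4], which is
    the series-parallel recursion for the effective conductance; the
    corresponding unit-voltage current is an admissible flow. *)

(** * Sums over spin configurations *)

Lemma filter_perm {A} (P : A -> bool) (l l' : list A) :
  Permutation l l' -> Permutation (filter P l) (filter P l').
Proof.
  induction 1 as [|x l l' _ IH|x y l|l l' l'' _ IH1 _ IH2]; simpl.
  - constructor.
  - destruct (P x); auto.
  - destruct (P x), (P y); auto. constructor.
  - now rewrite IH1.
Qed.

Lemma NoDup_app_inv {A} (l l' : list A) :
  NoDup (l ++ l') -> NoDup l /\ NoDup l' /\ (forall x, In x l -> ~ In x l').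
Proof.
  induction l as [|x l IH]; simpl; intros Hnd.
  - repeat split; auto. constructor.
  - inversion Hnd as [|? ? Hx Hnd']; subst. destruct (IH Hnd') as (H1 & H2 & H3).
    rewrite in_app_iff in Hx. repeat split; auto.
    + constructor; tauto.
    + intros y [<-|Hy]; auto.
Qed.

Definition agree_off (l : list nat) (s s' : nat -> bool) : Prop :=
  forall w, ~ In w l -> s' w = s w.

(** The sum visits only configurations that agree with [s] off [l], so the integrands may be
    compared there alone. This is how spins already fixed get evaluated. *)
Lemma sumcfg_ext (l : list nat) (s : nat -> bool) (f g : (nat -> bool) -> R) :
  (forall s', agree_off l s s' -> f s' = g s') -> sumcfg l s f = sumcfg l s g.
Proof.
  revert s; induction l as [|v l IH]; intros s Hfg; simpl.
  - apply Hfg. intros w _. reflexivity.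
  - f_equal; apply IH; intros s' Hs'; apply Hfg; intros w Hw;
      rewrite Hs' by (intro; apply Hw; now right);
      unfold upd; destruct (Nat.eqb_spec w v); auto; subst; exfalso; apply Hw; now left.
Qed.

Lemma sumcfg_app (l l' : list nat) (s : nat -> bool) (f : (nat -> bool) -> R) :
  sumcfg (l ++ l') s f = sumcfg l s (fun s' => sumcfg l' s' f).
Proof.
  revert s; induction l as [|v l IH]; intros s; simpl; [reflexivity|].
  now rewrite !IH.
Qed.

Lemma sumcfg_scal (l : list nat) (s : nat -> bool) (c : R) (f : (nat -> bool) -> R) :
  sumcfg l s (fun s' => c * f s') = c * sumcfg l s f.
Proof.
  revert s; induction l as [|v l IH]; intros s; simpl; [reflexivity|].
  rewrite !IH. ring.
Qed.

Lemma sumcfg_scal_r (l : list nat) (s : nat -> bool) (c : R) (f : (nat -> bool) -> R) :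
  sumcfg l s (fun s' => f s' * c) = sumcfg l s f * c.
Proof.
  revert s; induction l as [|v l IH]; intros s; simpl; [reflexivity|].
  rewrite !IH. ring.
Qed.

Lemma sumcfg_plus (l : list nat) (s : nat -> bool) (f g : (nat -> bool) -> R) :
  sumcfg l s (fun s' => f s' + g s') = sumcfg l s f + sumcfg l s g.
Proof.
  revert s; induction l as [|v l IH]; intros s; simpl; [reflexivity|].
  rewrite !IH. ring.
Qed.

Lemma sumcfg_swap (l l' : list nat) (s s' : nat -> bool) (x w : (nat -> bool) -> R)
  (h : (nat -> bool) -> (nat -> bool) -> R) :
  sumcfg l s (fun xi => x xi * sumcfg l' s' (fun sg => w sg * h xi sg)) =
  sumcfg l' s' (fun sg => w sg * sumcfg l s (fun xi => x xi * h xi sg)).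
Proof.
  revert s; induction l as [|v l IH]; intros s; simpl.
  - rewrite <- sumcfg_scal. apply sumcfg_ext. intros. ring.
  - rewrite !IH, <- sumcfg_plus. apply sumcfg_ext. intros. ring.
Qed.

Lemma sumcfg_pos (l : list nat) (s : nat -> bool) (f : (nat -> bool) -> R) :
  (forall s', 0 < f s') -> 0 < sumcfg l s f.
Proof.
  intros Hf. revert s; induction l as [|v l IH]; intros s; simpl; auto.
  apply Rplus_lt_0_compat; auto.
Qed.

Lemma upd_comm (s : nat -> bool) (v w : nat) (a b : bool) :
  v <> w -> upd (upd s v a) w b = upd (upd s w b) v a.
Proof.
  intros Hvw. apply functional_extensionality. intros u. unfold upd.
  destruct (Nat.eqb_spec u w), (Nat.eqb_spec u v); congruence.
Qed.

Lemma sumcfg_perm (l l' : list nat) (s : nat -> bool) (f : (nat -> bool) -> R) :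
  Permutation l l' -> NoDup l -> sumcfg l s f = sumcfg l' s f.
Proof.
  intros Hp. revert s. induction Hp as [|x l l' Hp IH|x y l|l l' l'' H1 IH1 H2 IH2];
    intros s Hnd; simpl.
  - reflexivity.
  - inversion Hnd; subst. now rewrite !IH.
  - inversion Hnd as [|? ? Hy Hnd']; subst.
    assert (y <> x) by (intros ->; apply Hy; now left).
    rewrite !(upd_comm s y x) by assumption. ring.
  - rewrite IH1 by assumption. apply IH2. eapply Permutation_NoDup; eauto.
Qed.

Definition prodl (h : nat -> R) (l : list nat) : R :=
  fold_right Rmult 1 (map h l).

Lemma prodl_cons (h : nat -> R) (w : nat) (l : list nat) :
  prodl h (w :: l) = h w * prodl h l.
Proof. reflexivity. Qed.

Lemma prodl_app (h : nat -> R) (l l' : list nat) :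
  prodl h (l ++ l') = prodl h l * prodl h l'.
Proof.
  induction l as [|w l IH]; simpl.
  - unfold prodl; simpl. ring.
  - rewrite !prodl_cons, IH. ring.
Qed.

Lemma prodl_perm (h : nat -> R) (l l' : list nat) :
  Permutation l l' -> prodl h l = prodl h l'.
Proof.
  induction 1; rewrite ?prodl_cons; try congruence. ring.
Qed.

Lemma prodl_mult (h h' : nat -> R) (l : list nat) :
  prodl (fun w => h w * h' w) l = prodl h l * prodl h' l.
Proof.
  induction l as [|w l IH].
  - unfold prodl; simpl; ring.
  - rewrite !prodl_cons, IH. ring.
Qed.

(** Lets pinned vertices be summed over like free ones, the pins becoming indicator weights that can
    be absorbed into a transition kernel. *)
Lemma sumcfg_filter (l : list nat) (fixed : nat -> bool) (b s : nat -> bool)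
  (f : (nat -> bool) -> R) :
  NoDup l -> (forall w, In w l -> fixed w = true -> s w = b w) ->
  sumcfg (filter (fun w => negb (fixed w)) l) s f =
  sumcfg l s (fun s' =>
    prodl (fun w => if fixed w then ind (Bool.eqb (s' w) (b w)) else 1) l * f s').
Proof.
  revert s f; induction l as [|v l IH]; intros s f Hnd Hb; simpl.
  - unfold prodl; simpl. ring.
  - inversion Hnd as [|? ? Hv Hnd']; subst.
    assert (Hupd : forall c w, In w l -> upd s v c w = s w).
    { intros c w Hw. unfold upd. destruct (Nat.eqb_spec w v); congruence. }
    assert (Hterm : forall c,
      sumcfg l (upd s v c) (fun s' => prodl (fun w => if fixed w then ind (Bool.eqb (s' w) (b w)) else 1) (v :: l) * f s')
      = (if fixed v then ind (Bool.eqb c (b v)) else 1) *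
        sumcfg (filter (fun w => negb (fixed w)) l) (upd s v c) f).
    { intros c. rewrite IH, <- sumcfg_scal; auto.
      - apply sumcfg_ext. intros s' Hs'. rewrite prodl_cons.
        rewrite (Hs' v Hv). unfold upd at 1. rewrite Nat.eqb_refl. ring.
      - intros w Hw Hf. rewrite Hupd by assumption. apply Hb; auto. now right. }
    rewrite !Hterm. destruct (fixed v) eqn:Hf; simpl.
    + assert (Hs : s = upd s v (b v)).
      { apply functional_extensionality. intros w. unfold upd.
        destruct (Nat.eqb_spec w v); auto. subst. apply Hb; auto. now left. }
      rewrite Hs at 1. destruct (b v); simpl; unfold ind; simpl; ring.
    + ring.
Qed.

(** Collapses a sum over boundary conditions against the indicator of the one that is realised. *)
Lemma sumcfg_dirac (l : list nat) (s sg : nat -> bool) (f : (nat -> bool) -> R) (c : R) :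
  NoDup l ->
  (forall s', agree_off l s s' -> (forall w, In w l -> s' w = sg w) -> f s' = c) ->
  sumcfg l s (fun s' => f s' * ind (forallb (fun w => Bool.eqb (sg w) (s' w)) l)) = c.
Proof.
  revert s f; induction l as [|v l IH]; intros s f Hnd Hf; simpl.
  - unfold ind. rewrite Hf; [ring| |]; [intros w _; reflexivity|intros w []].
  - inversion Hnd as [|? ? Hv Hnd']; subst.
    assert (Hterm : forall d,
      sumcfg l (upd s v d) (fun s' => f s' * ind (Bool.eqb (sg v) (s' v) && forallb (fun w => Bool.eqb (sg w) (s' w)) l))
      = ind (Bool.eqb (sg v) d) * c).
    { intros d. destruct (Bool.eqb (sg v) d) eqn:Hd.
      - apply eqb_prop in Hd. subst d.
        unfold ind at 2. rewrite Rmult_1_l.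
        rewrite <- (IH (upd s v (sg v)) f Hnd').
        + apply sumcfg_ext. intros s' Hs'. rewrite (Hs' v Hv).
          unfold upd at 1. rewrite Nat.eqb_refl, eqb_reflx. reflexivity.
        + intros s' Hs' Hl. apply Hf.
          * intros w Hw. rewrite Hs' by (intro; apply Hw; now right).
            unfold upd. destruct (Nat.eqb_spec w v); auto. subst. exfalso; apply Hw; now left.
          * intros w [<-|Hw]; auto. rewrite (Hs' v Hv). unfold upd. now rewrite Nat.eqb_refl.
      - transitivity (sumcfg l (upd s v d) (fun s' => 0 * f s')).
        + apply sumcfg_ext. intros s' Hs'. rewrite (Hs' v Hv).
          unfold upd at 1. rewrite Nat.eqb_refl, Hd. unfold ind; simpl. ring.
        + rewrite sumcfg_scal. unfold ind. ring. }
    rewrite !Hterm. destruct (sg v); unfold ind; simpl; ring.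
Qed.

(** * Forests and tree-indexed Markov chains *)

(* First-child/next-sibling encoding: [Cons w ch sib] is the forest whose first
   root is [w], with children [ch], followed by the forest [sib]. *)
Inductive forest : Type :=
| Nil : forest
| Cons : nat -> forest -> forest -> forest.

Fixpoint dfs (F : forest) : list nat :=
  match F with
  | Nil => []
  | Cons w ch sib => w :: dfs ch ++ dfs sib
  end.

Fixpoint prune (H : nat -> bool) (F : forest) : forest :=
  match F with
  | Nil => Nil
  | Cons w ch sib =>
      if H w then Cons w (prune H ch) (prune H sib) else prune H sib
  end.

(* Here and in [Zf] and [Ex], [a] is the spin of the common parent of the roots. *)
Fixpoint wt (K : nat -> bool -> bool -> R) (F : forest) (a : bool) (s : nat -> bool) : R :=
  match F with
  | Nil => 1
  | Cons w ch sib => K w a (s w) * wt K ch (s w) s * wt K sib a s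
  end.

Fixpoint Zf (K : nat -> bool -> bool -> R) (F : forest) (a : bool) : R :=
  match F with
  | Nil => 1
  | Cons w ch sib =>
      (K w a true * Zf K ch true + K w a false * Zf K ch false) * Zf K sib a
  end.

Inductive out : Type :=
| ONil : out
| OCons : bool -> out -> out -> out.

Definition lab (ch : forest) (b : bool) : bool :=
  match ch with Nil => b | _ => true end.

(* Only the spins of the leaves are recorded; inner labels are always [true]. *)
Fixpoint read (F : forest) (s : nat -> bool) : out :=
  match F with
  | Nil => ONil
  | Cons w ch sib => OCons (lab ch (s w)) (read ch s) (read sib s)
  end.

(* Expectation under the Markov chain indexed by [F] with transition matrices [p]. *)
Fixpoint Ex (p : nat -> bool -> bool -> R) (F : forest) (a : bool) (g : out -> R) : R :=
  match F with
  | Nil => g ONil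
  | Cons w ch sib =>
      p w a true * Ex p ch true (fun o1 => Ex p sib a (fun o2 => g (OCons (lab ch true) o1 o2)))
      + p w a false * Ex p ch false (fun o1 => Ex p sib a (fun o2 => g (OCons (lab ch false) o1 o2)))
  end.

Lemma wt_ext K F a s s' : (forall w, In w (dfs F) -> s w = s' w) -> wt K F a s = wt K F a s'.
Proof.
  revert a; induction F as [|w ch IHc sib IHs]; intros a Hs; simpl; [reflexivity|].
  rewrite (Hs w) by now left.
  rewrite IHc, IHs; auto; intros u Hu; apply Hs; simpl; right; apply in_or_app; auto.
Qed.

Lemma read_ext F s s' : (forall w, In w (dfs F) -> s w = s' w) -> read F s = read F s'.
Proof.
  induction F as [|w ch IHc sib IHs]; intros Hs; simpl; [reflexivity|].
  rewrite (Hs w) by now left.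
  rewrite IHc, IHs; auto; intros u Hu; apply Hs; simpl; right; apply in_or_app; auto.
Qed.

Lemma in_dfs_prune H F w : In w (dfs (prune H F)) -> In w (dfs F).
Proof.
  induction F as [|u ch IHc sib IHs]; simpl; auto.
  destruct (H u); simpl; rewrite ?in_app_iff; tauto.
Qed.

(** Spatial Markov property: once the spin of [w] is fixed, the weight splits into a factor for its
    children and one for its siblings. *)
Lemma sumcfg_dfs_Cons K w ch sib a s (h : (nat -> bool) -> R) :
  NoDup (dfs (Cons w ch sib)) ->
  sumcfg (dfs (Cons w ch sib)) s (fun s' => wt K (Cons w ch sib) a s' * h s') =
  K w a true * sumcfg (dfs ch) (upd s w true) (fun s1 => wt K ch true s1 *
     sumcfg (dfs sib) s1 (fun s2 => wt K sib a s2 * h s2)) +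
  K w a false * sumcfg (dfs ch) (upd s w false) (fun s1 => wt K ch false s1 *
     sumcfg (dfs sib) s1 (fun s2 => wt K sib a s2 * h s2)).
Proof.
  intros Hnd. simpl in Hnd. inversion Hnd as [|? ? Hw Hnd']; subst.
  destruct (NoDup_app_inv _ _ Hnd') as (Hc & Hs & Hd).
  rewrite in_app_iff in Hw.
  assert (Hterm : forall b,
    sumcfg (dfs ch ++ dfs sib) (upd s w b) (fun s' => wt K (Cons w ch sib) a s' * h s') =
    K w a b * sumcfg (dfs ch) (upd s w b) (fun s1 => wt K ch b s1 *
     sumcfg (dfs sib) s1 (fun s2 => wt K sib a s2 * h s2))).
  { intros b. rewrite sumcfg_app, <- sumcfg_scal. apply sumcfg_ext. intros s1 Hs1.
    rewrite <- Rmult_assoc, <- sumcfg_scal. apply sumcfg_ext. intros s2 Hs2. simpl.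
    assert (E : s2 w = b).
    { rewrite Hs2, Hs1 by tauto. unfold upd. now rewrite Nat.eqb_refl. }
    rewrite E, (wt_ext K ch b s2 s1).
    - ring.
    - intros u Hu. apply Hs2. auto. }
  change (dfs (Cons w ch sib)) with (w :: (dfs ch ++ dfs sib)).
  cbn [sumcfg]. now rewrite !Hterm.
Qed.

Lemma NoDup_Cons_inv w ch sib : NoDup (dfs (Cons w ch sib)) ->
  ~ In w (dfs ch) /\ ~ In w (dfs sib) /\ NoDup (dfs ch) /\ NoDup (dfs sib) /\
  (forall x, In x (dfs ch) -> ~ In x (dfs sib)).
Proof.
  simpl. intros Hnd. inversion Hnd as [|? ? Hw Hnd']; subst.
  destruct (NoDup_app_inv _ _ Hnd') as (Hc & Hs & Hd).
  rewrite in_app_iff in Hw. tauto.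
Qed.

Lemma sumcfg_wt K F a s :
  NoDup (dfs F) -> sumcfg (dfs F) s (fun s' => wt K F a s' * 1) = Zf K F a.
Proof.
  revert a s; induction F as [|w ch IHc sib IHs]; intros a s Hnd.
  - simpl. ring.
  - rewrite sumcfg_dfs_Cons by assumption.
    destruct (NoDup_Cons_inv _ _ _ Hnd) as (_ & _ & Hc & Hs & _).
    assert (E : forall b t, sumcfg (dfs ch) t (fun s1 => wt K ch b s1 *
       sumcfg (dfs sib) s1 (fun s2 => wt K sib a s2 * 1)) = Zf K ch b * Zf K sib a).
    { intros b t. rewrite <- (IHc b t Hc), <- sumcfg_scal_r. apply sumcfg_ext.
      intros s1 _. rewrite IHs by assumption. ring. }
    rewrite !E. simpl. ring.
Qed.

Definition markov (p : nat -> bool -> bool -> R) : Prop :=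
  forall w a, p w a true + p w a false = 1.

Lemma Ex_ext p F a g g' : (forall o, g o = g' o) -> Ex p F a g = Ex p F a g'.
Proof. intros Hg. f_equal. now apply functional_extensionality. Qed.

Lemma Ex_const p F a c : markov p -> Ex p F a (fun _ => c) = c.
Proof.
  intros Hp. revert a; induction F as [|w ch IHc sib IHs]; intros a; simpl; [reflexivity|].
  rewrite IHs, !IHc, <- Rmult_plus_distr_r, Hp. ring.
Qed.

(** Marginalisation onto the pruned forest: every subtree cut off carries total mass one, because
    the rows of [p] sum to one. *)
Lemma sumcfg_Ex p H F a s (g : out -> R) :
  markov p -> NoDup (dfs F) ->
  sumcfg (dfs F) s (fun s' => wt p F a s' * g (read (prune H F) s')) =
  Ex p (prune H F) a g.
Proof.
  intros Hp. revert a s g; induction F as [|w ch IHc sib IHs]; intros a s g Hnd.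
  - simpl. ring.
  - rewrite sumcfg_dfs_Cons by assumption.
    destruct (NoDup_Cons_inv _ _ _ Hnd) as (Hwc & Hws & Hc & Hs & Hd).
    simpl prune. destruct (H w) eqn:Hw.
    + assert (E : forall b, sumcfg (dfs ch) (upd s w b) (fun s1 => wt p ch b s1 *
        sumcfg (dfs sib) s1 (fun s2 => wt p sib a s2 * g (read (Cons w (prune H ch) (prune H sib)) s2)))
        = Ex p (prune H ch) b (fun o1 => Ex p (prune H sib) a (fun o2 => g (OCons (lab (prune H ch) b) o1 o2)))).
      { intros b. rewrite <- (IHc b (upd s w b)) by assumption. apply sumcfg_ext. intros s1 Hs1.
        f_equal. rewrite <- (IHs a s1) by assumption. apply sumcfg_ext. intros s2 Hs2.
        f_equal. simpl. f_equal. f_equal.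
        - f_equal. rewrite Hs2, Hs1 by assumption. unfold upd. now rewrite Nat.eqb_refl.
        - apply read_ext. intros u Hu. apply Hs2. apply Hd. eapply in_dfs_prune; eauto. }
      rewrite !E. reflexivity.
    + assert (E : forall b, sumcfg (dfs ch) (upd s w b) (fun s1 => wt p ch b s1 *
        sumcfg (dfs sib) s1 (fun s2 => wt p sib a s2 * g (read (prune H sib) s2)))
        = Ex p (prune H sib) a g).
      { intros b. rewrite <- (Ex_const p (prune H ch) b (Ex p (prune H sib) a g) Hp) at 1.
        rewrite <- (IHc b (upd s w b)) by assumption. apply sumcfg_ext. intros s1 _.
        now rewrite IHs. }
      rewrite !E, <- Rmult_plus_distr_r, Hp. ring.
Qed.

(** * The message function *)

(* [fmsg (exp (2 * beta)) x = 2 artanh (tanh beta * tanh (x / 2))], and its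
   derivative is [theta / (1 + (1 - theta^2) sinh^2 (x / 2))]. *)
Definition fmsg (q x : R) : R := ln ((q * exp x + 1) / (exp x + q)).

(** Equals [tanh beta] when [q = exp (2 * beta)]. *)
Definition theta_of (q : R) : R := (q - 1) / (q + 1).

(** The derivative of [fmsg q] at the points where [4 sinh^2 (x / 2) = d], that is
    [theta / (1 + (1 - theta^2) d / 4)]; it decreases in [d]. *)
Definition slope (q d : R) : R := (q ^ 2 - 1) / ((q + 1) ^ 2 + q * d).

Lemma fmsg_derive (q x : R) : 0 < q ->
  derivable_pt_lim (fmsg q) x (slope q (exp x + / exp x - 2)).
Proof.
  intros Hq. pose proof (exp_pos x) as Hz. apply is_derive_Reals.
  unfold fmsg, slope. auto_derive.
  - split; [nra|]. split; [|exact I]. apply Rdiv_lt_0_compat; nra.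
  - field. repeat split; nra.
Qed.

Lemma exp_cosh_ge (x : R) : x ^ 2 / 4 <= exp x + / exp x - 2.
Proof.
  (* Doubling the variable turns the right side into the square of [exp y - / exp y], which is at
     least [y] for [y >= 0]; negative arguments follow by evenness. *)
  assert (Hpos : forall y, 0 <= y -> (2 * y) ^ 2 / 4 <= exp (2 * y) + / exp (2 * y) - 2).
  { intros y Hy. pose proof (exp_ineq1_le y) as He. pose proof (exp_pos y) as Hz.
    replace (2 * y) with (y + y) at 2 3 by ring. rewrite !exp_plus.
    set (z := exp y) in *.
    assert (Hiz : / z <= 1) by (rewrite <- Rinv_1; apply Rinv_le_contravar; lra).
    replace (z * z + / (z * z) - 2) with ((z - / z) ^ 2) by (field; lra).
    assert (y <= z - / z) by lra. nra. }
  destruct (Rle_dec 0 x) as [Hx|Hx].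
  - specialize (Hpos (x / 2)). replace (2 * (x / 2)) with x in Hpos by field. apply Hpos. lra.
  - specialize (Hpos (- x / 2)). replace (2 * (- x / 2)) with (- x) in Hpos by field.
    rewrite exp_Ropp, Rinv_inv in Hpos. specialize (Hpos ltac:(lra)). lra.
Qed.

Lemma fmsg_increment (q d x y : R) : 1 < q -> 0 <= d -> x <= y ->
  (forall t, x < t < y -> d <= t ^ 2 / 4) ->
  0 <= fmsg q y - fmsg q x <= slope q d * (y - x).
Proof.
  intros Hq Hd [Hxy|<-] Ht; [|lra].
  destruct (MVT_cor2 (fmsg q) (fun t => slope q (exp t + / exp t - 2)) x y Hxy) as (t & E & Hxt).
  { intros t _. apply fmsg_derive. lra. }
  rewrite E. specialize (Ht t Hxt). pose proof (exp_cosh_ge t) as Hc.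
  set (e := exp t + / exp t - 2) in *.
  assert (0 < (q + 1) ^ 2 + q * d) by nra.
  assert ((q + 1) ^ 2 + q * d <= (q + 1) ^ 2 + q * e) by nra.
  unfold slope. split.
  - apply Rmult_le_pos; [|lra]. apply Rle_mult_inv_pos; nra.
  - apply Rmult_le_compat_r; [lra|]. unfold Rdiv. apply Rmult_le_compat_l; [nra|].
    now apply Rinv_le_contravar.
Qed.

Lemma slope_0 (q : R) : 1 < q -> slope q 0 = theta_of q.
Proof. intros Hq. unfold slope, theta_of. field. lra. Qed.

Definition clamp (c x : R) : R := Rmax (- c) (Rmin c x).

(* Says that [slope * x + (theta - slope) * clamp c x - fmsg x] is nondecreasing. *)
Lemma fmsg_clamp_increment (q c x y : R) : 1 < q -> 0 <= c -> x <= y ->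
  fmsg q y - fmsg q x <=
  slope q (c ^ 2 / 4) * (y - x) +
  (theta_of q - slope q (c ^ 2 / 4)) * (clamp c y - clamp c x).
Proof.
  intros Hq Hc Hxy. rewrite <- slope_0 by assumption.
  set (l := slope q (c ^ 2 / 4)). set (th := slope q 0).
  assert (Hall : forall u v, u <= v -> fmsg q v - fmsg q u <= th * (v - u)).
  { intros u v Huv. apply fmsg_increment; try lra. intros t _. nra. }
  (* Outside the window from [-c] to [c] the derivative is at most [l]; inside it is at most [th].
     The case analysis then cuts the interval from [x] to [y] at the window's ends. *)
  assert (Hfar : forall u v, u <= v -> c <= u \/ v <= - c -> fmsg q v - fmsg q u <= l * (v - u)).
  { intros u v Huv Ho. apply fmsg_increment; try lra; [nra|]. intros t Ht.
    destruct Ho; nra. }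
  unfold clamp, Rmax, Rmin.
  destruct (Rle_dec x (- c)) as [H1|H1]; destruct (Rle_dec y (- c)) as [H2|H2];
  destruct (Rle_dec c x) as [H3|H3]; destruct (Rle_dec c y) as [H4|H4];
  repeat match goal with |- context [Rle_dec ?a ?b] => destruct (Rle_dec a b); try lra end;
  try (pose proof (Hall x y Hxy));
  try (pose proof (Hfar x y Hxy ltac:(lra)));
  try (pose proof (Hfar x (- c) ltac:(lra) ltac:(lra)));
  try (pose proof (Hfar c y ltac:(lra) ltac:(lra)));
  try (pose proof (Hall x c ltac:(lra)));
  try (pose proof (Hall (- c) y ltac:(lra)));
  try (pose proof (Hall (- c) c ltac:(lra)));
  try lra; try nra.
Qed.

(** The argument of the logarithm lies between [1 / q] and [q]. *)
Lemma fmsg_bound (beta x : R) : 0 < beta ->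
  - (2 * beta) <= fmsg (exp (2 * beta)) x <= 2 * beta.
Proof.
  intros Hb. unfold fmsg. pose proof (exp_ineq1_le (2 * beta)) as He.
  pose proof (exp_pos x) as Hx. pose proof (ln_exp (2 * beta)) as Hl.
  set (q := exp (2 * beta)) in *.
  assert (Hq : 1 < q) by lra.
  rewrite <- Hl, <- ln_Rinv by lra.
  split; apply ln_le.
  - apply Rinv_0_lt_compat; lra.
  - apply Rmult_le_reg_r with (q * (exp x + q)); [nra|].
    replace (/ q * (q * (exp x + q))) with (exp x + q) by (field; lra).
    replace ((q * exp x + 1) / (exp x + q) * (q * (exp x + q)))
      with (q * (q * exp x + 1)) by (field; lra).
    assert (exp x <= q * exp x) by nra. nra.
  - apply Rdiv_lt_0_compat; nra.
  - apply Rmult_le_reg_r with (exp x + q); [lra|].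
    replace ((q * exp x + 1) / (exp x + q) * (exp x + q)) with (q * exp x + 1) by (field; lra).
    nra.
Qed.

(** * The nonlinear recursion *)

Section Chain.

Variables (beta : R) (u : nat -> bool -> R).
Hypothesis Hbeta : 0 < beta.
Hypothesis Hu : forall w, 0 <= u w true /\ 0 <= u w false /\ 0 < u w true + u w false.

Let q := exp (2 * beta).
Let th := theta_of q.

(** Reading [u w b] as the total weight of everything at and below [w] when its spin is [b], this is
    the normaliser of the step from a parent of spin [a] to [w]. *)
Definition Sp (w : nat) (a : bool) : R :=
  exp (beta * (spin a * spin true)) * u w true +
  exp (beta * (spin a * spin false)) * u w false.

Definition pk (w : nat) (a b : bool) : R :=
  exp (beta * (spin a * spin b)) * u w b / Sp w a.

Lemma Sp_pos w a : 0 < Sp w a.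
Proof.
  unfold Sp. destruct (Hu w) as (H1 & H2 & H3).
  pose proof (exp_pos (beta * (spin a * spin true))).
  pose proof (exp_pos (beta * (spin a * spin false))).
  destruct H1 as [H1|H1]; [nra|]. rewrite <- H1 in *. nra.
Qed.

Lemma pk_markov : markov pk.
Proof.
  intros w a. pose proof (Sp_pos w a). unfold pk.
  rewrite <- Rdiv_plus_distr. fold (Sp w a). field. lra.
Qed.

Lemma pk_ge0 w a b : 0 <= pk w a b.
Proof.
  unfold pk. apply Rle_mult_inv_pos; [|apply Sp_pos].
  apply Rmult_le_pos; [left; apply exp_pos|]. destruct b; apply Hu.
Qed.

Lemma q_gt1 : 1 < q.
Proof. unfold q. pose proof (exp_ineq1 (2 * beta)). lra. Qed.

Lemma theta_bounds : 0 < th < 1.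
Proof.
  pose proof q_gt1. unfold th, theta_of. split.
  - apply Rdiv_lt_0_compat; lra.
  - apply Rmult_lt_reg_r with (q + 1); [lra|]. field_simplify; lra.
Qed.

Lemma exp_spin_pp : exp (beta * (spin true * spin true)) = exp beta.
Proof. f_equal. simpl. ring. Qed.
Lemma exp_spin_mm : exp (beta * (spin false * spin false)) = exp beta.
Proof. f_equal. simpl. ring. Qed.
Lemma exp_spin_pm : exp (beta * (spin true * spin false)) = / exp beta.
Proof. rewrite <- exp_Ropp. f_equal. simpl. ring. Qed.
Lemma exp_spin_mp : exp (beta * (spin false * spin true)) = / exp beta.
Proof. rewrite <- exp_Ropp. f_equal. simpl. ring. Qed.

Lemma exp_double : q = exp beta * exp beta.
Proof. unfold q. rewrite <- exp_plus. f_equal. ring. Qed.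

(** With [r = exp (2 * beta)], [x = u w true] and [y = u w false], the influence is
    [x y (r^2 - 1) / ((r x + y) (x + r y))], which is largest at [x = y], where it equals
    [theta]. *)
Lemma pk_influence w : 0 <= pk w true true - pk w false true <= th.
Proof.
  pose proof (Sp_pos w true) as S1. pose proof (Sp_pos w false) as S2.
  pose proof (exp_pos beta) as He. pose proof q_gt1 as Hq.
  destruct (Hu w) as (H1 & H2 & H3).
  unfold pk, th, theta_of, Sp in *.
  rewrite exp_spin_pp, exp_spin_pm, exp_spin_mp, exp_spin_mm in *.
  rewrite exp_double in *. set (e := exp beta) in *.
  set (x := u w true) in *. set (y := u w false) in *.
  assert (P1 : 0 < e * e * x + y).
  { replace (e * e * x + y) with (e * (e * x + / e * y)) by (field; lra). nra. }
  assert (P2 : 0 < x + e * e * y).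
  { replace (x + e * e * y) with (e * (/ e * x + e * y)) by (field; lra). nra. }
  replace (e * x / (e * x + / e * y) - / e * x / (/ e * x + e * y))
    with (x * y * ((e * e) ^ 2 - 1) / ((e * e * x + y) * (x + e * e * y)))
    by (field; repeat split; lra).
  set (r := e * e) in *.
  assert (Hxy : 0 <= x * y) by nra.
  assert (PP : 0 < (r * x + y) * (x + r * y)) by nra.
  split.
  - apply Rle_mult_inv_pos; [apply Rmult_le_pos; nra|assumption].
  - apply Rmult_le_reg_r with ((r * x + y) * (x + r * y)); [assumption|].
    unfold Rdiv at 1. rewrite Rmult_assoc, Rinv_l, Rmult_1_r by lra.
    apply Rmult_le_reg_r with (r + 1); [lra|].
    replace ((r - 1) / (r + 1) * ((r * x + y) * (x + r * y)) * (r + 1))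
      with ((r - 1) * ((r * x + y) * (x + r * y))) by (field; lra).
    (* After clearing denominators this is exactly the difference of the two sides. *)
    assert (0 <= (r - 1) * (r * (x - y) ^ 2)).
    { apply Rmult_le_pos; [lra|]. apply Rmult_le_pos; [lra|apply pow2_ge_0]. }
    lra.
Qed.

(** * Expectations under the chain and stochastic domination *)

Notation E := (Ex pk).

Lemma Ex_plus F a g h : E F a (fun o => g o + h o) = E F a g + E F a h.
Proof.
  revert a g h; induction F as [|w ch IHc sib IHs]; intros a g h; simpl; [reflexivity|].
  assert (HE : forall b,
    E ch b (fun o1 => E sib a (fun o2 => g (OCons (lab ch b) o1 o2) + h (OCons (lab ch b) o1 o2))) =
    E ch b (fun o1 => E sib a (fun o2 => g (OCons (lab ch b) o1 o2))) +
    E ch b (fun o1 => E sib a (fun o2 => h (OCons (lab ch b) o1 o2)))).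
  { intros b. rewrite <- IHc. apply Ex_ext. intros o1. apply IHs. }
  rewrite !HE. ring.
Qed.

Lemma Ex_scal F a c g : E F a (fun o => c * g o) = c * E F a g.
Proof.
  revert a g; induction F as [|w ch IHc sib IHs]; intros a g; simpl; [reflexivity|].
  assert (HE : forall b,
    E ch b (fun o1 => E sib a (fun o2 => c * g (OCons (lab ch b) o1 o2))) =
    c * E ch b (fun o1 => E sib a (fun o2 => g (OCons (lab ch b) o1 o2)))).
  { intros b. rewrite <- IHc. apply Ex_ext. intros o1. apply IHs. }
  rewrite !HE. ring.
Qed.

Lemma Ex_le F a g h : (forall o, g o <= h o) -> E F a g <= E F a h.
Proof.
  revert a g h; induction F as [|w ch IHc sib IHs]; intros a g h Hgh; simpl; auto.
  apply Rplus_le_compat; (apply Rmult_le_compat_l; [apply pk_ge0|]); auto.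
Qed.

Inductive ole : out -> out -> Prop :=
| ole_Nil : ole ONil ONil
| ole_Cons b b' o1 o1' o2 o2' : (b = true -> b' = true) -> ole o1 o1' -> ole o2 o2' ->
    ole (OCons b o1 o2) (OCons b' o1' o2').

Lemma ole_refl o : ole o o.
Proof. induction o; constructor; auto. Qed.

Definition omono (g : out -> R) : Prop := forall o o', ole o o' -> g o <= g o'.

(** By [pk_influence], a parent spin [+] makes each child more likely to be [+]; the induction
    carries this down to the recorded leaf spins. *)
Lemma Ex_mono F g : omono g -> E F false g <= E F true g.
Proof.
  revert g; induction F as [|w ch IHc sib IHs]; intros g Hg; simpl; [lra|].
  set (A := fun b a => E ch b (fun o1 => E sib a (fun o2 => g (OCons (lab ch b) o1 o2)))).
  change (pk w false true * A true false + pk w false false * A false false <=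
          pk w true true * A true true + pk w true false * A false true).
  assert (H1 : forall b, A b false <= A b true).
  { intros b. apply Ex_le. intros o1. apply IHs. intros o2 o2' Ho. apply Hg.
    constructor; auto using ole_refl. }
  (* Raising the spin of [w] acts twice: on the law of its children, then on its own recorded label.
     The two changes are made one after the other. *)
  assert (H2 : A false false <= A true false).
  { apply Rle_trans with (E ch true (fun o1 => E sib false (fun o2 => g (OCons (lab ch false) o1 o2)))).
    - apply IHc. intros o1 o1' Ho. apply Ex_le. intros o2. apply Hg.
      constructor; auto using ole_refl.
    - apply Ex_le. intros o1. apply Ex_le. intros o2. apply Hg.
      constructor; auto using ole_refl. destruct ch; simpl; auto. }
  pose proof (H1 true). pose proof (H1 false).
  pose proof (pk_ge0 w true true). pose proof (pk_ge0 w true false).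
  pose proof (pk_markov w true). pose proof (pk_markov w false).
  destruct (pk_influence w) as [Hi _].
  assert (pk w false false = 1 - pk w false true) as -> by lra.
  assert (pk w true false = 1 - pk w true true) as -> by lra.
  assert (pk w true true * A true false <= pk w true true * A true true) by nra.
  assert ((1 - pk w true true) * A false false <= (1 - pk w true true) * A false true) by nra.
  nra.
Qed.

(* For [al = 0] this is the log-ratio [x_v] of the paper; the shifts [al] play
   the role of an external field coming from the vertices outside of hat T. *)
Fixpoint X (al : nat -> forest -> R) (F : forest) (o : out) : R :=
  match F, o with
  | Cons w ch sib, OCons b o1 o2 =>
      match ch with
      | Nil => 2 * beta * spin b
      | _ => fmsg q (al w ch + X al ch o1)
      end + X al sib o2
  | _, _ => 0
  end.

Lemma fmsg_mono x y : x <= y -> fmsg q x <= fmsg q y.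
Proof.
  intros Hxy. pose proof q_gt1.
  destruct (fmsg_increment q 0 x y); try lra. intros t _. nra.
Qed.

Lemma X_mono al F : omono (X al F).
Proof.
  induction F as [|w ch IHc sib IHs]; intros o o' Ho.
  - destruct o, o'; simpl; lra.
  - destruct Ho as [|b b' o1 o1' o2 o2' Hb H1 H2]; simpl; [lra|].
    apply Rplus_le_compat; [|now apply IHs].
    destruct ch as [|w' ch' sib'].
    + destruct b; [rewrite Hb by reflexivity; lra|]. destruct b'; simpl; lra.
    + apply fmsg_mono. apply Rplus_le_compat_l. now apply IHc.
Qed.

(** Additive constant of the log-likelihood ratio: the normalisers [Sp] of the roots depend on the
    parent's spin. *)
Fixpoint kF (F : forest) : R :=
  match F with
  | Nil => 0
  | Cons w ch sib => ln (Sp w true / Sp w false) + kF sib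
  end.

(** Chosen so that [alstar w ch + X alstar ch o] is the log-odds of the spin at [w]: prior odds from
    [u] plus the log-likelihood ratio [llr ch o]. *)
Definition alstar (w : nat) (ch : forest) : R := ln (u w true / u w false) - kF ch.

Fixpoint posF (F : forest) : Prop :=
  match F with
  | Nil => True
  | Cons w ch sib => (0 < u w true /\ 0 < u w false) /\ posF ch /\ posF sib
  end.

Definition llr (F : forest) (o : out) : R := X alstar F o - kF F.

(* The statistic [X alstar] is, up to a constant, the log-likelihood ratio
   between the laws of the leaf spins given root spin [+] and [-]. *)
Lemma Ex_llr F g : posF F -> E F true g = E F false (fun o => exp (llr F o) * g o).
Proof.
  revert g; induction F as [|w ch IHc sib IHs]; intros g Hpos.
  - unfold llr. simpl. rewrite Rminus_0_r, exp_0. ring.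
  - destruct Hpos as ((U1 & U2) & Pc & Ps). specialize (IHc) with (1 := Pc).
    specialize (IHs) with (1 := Ps).
    pose proof (Sp_pos w true) as S1. pose proof (Sp_pos w false) as S2.
    pose proof (exp_pos beta) as He.
    assert (HS : exp (ln (Sp w true / Sp w false)) = Sp w true / Sp w false).
    { apply exp_ln. now apply Rdiv_lt_0_compat. }
    destruct ch as [|w' ch' sib'].
    + simpl. rewrite !IHs.
      assert (Hr : forall b, pk w true b =
        pk w false b * (exp (2 * beta * spin b) * / (Sp w true / Sp w false))).
      { intros b. unfold pk. rewrite !(Rmult_comm (exp _) (u w b)).
        replace (exp (beta * (spin true * spin b))) with
          (exp (beta * (spin false * spin b)) * exp (2 * beta * spin b)).
        - field. lra.
        - rewrite <- exp_plus. f_equal. simpl. ring. }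
      assert (Hb : forall b, E sib false (fun o2 => exp (llr (Cons w Nil sib) (OCons b ONil o2)) * g (OCons b ONil o2))
        = (exp (2 * beta * spin b) * / (Sp w true / Sp w false)) *
          E sib false (fun o2 => exp (llr sib o2) * g (OCons b ONil o2))).
      { intros b. rewrite <- Ex_scal. apply Ex_ext. intros o2.
        rewrite <- Rmult_assoc. f_equal. rewrite <- HS, <- exp_Ropp, <- !exp_plus.
        f_equal. unfold llr. cbn [X kF]. ring. }
      rewrite !Hb, (Hr true), (Hr false). ring.
    + set (ch := Cons w' ch' sib') in *.
      assert (Hl : forall b, lab ch b = true) by reflexivity.
      cbn [Ex]. rewrite !Hl.
      (* The spin of an inner [w] is not recorded, so its two values get mixed. Both branches are
         moved to the law of [ch] under spin [-], where the mixed likelihood ratio is [fmsg] of the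
         log-odds, up to the normalisers. *)
      rewrite (IHc (fun o1 => E sib true (fun o2 => g (OCons true o1 o2)))).
      rewrite (IHc (fun o1 => E sib false (fun o2 => exp (llr (Cons w ch sib) (OCons true o1 o2)) * g (OCons true o1 o2)))).
      rewrite <- !Ex_scal, <- !Ex_plus. apply Ex_ext. intros o1.
      rewrite IHs.
      assert (Hb : E sib false (fun o2 => exp (llr (Cons w ch sib) (OCons true o1 o2)) * g (OCons true o1 o2))
        = (exp (fmsg q (alstar w ch + X alstar ch o1)) * / (Sp w true / Sp w false)) *
          E sib false (fun o2 => exp (llr sib o2) * g (OCons true o1 o2))).
      { rewrite <- Ex_scal. apply Ex_ext. intros o2.
        rewrite <- Rmult_assoc. f_equal. rewrite <- HS, <- exp_Ropp, <- !exp_plus.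
        f_equal. unfold llr, ch. cbn [X kF]. ring. }
      rewrite Hb. set (G := E sib false _). clearbody G.
      assert (Hz : exp (alstar w ch + X alstar ch o1) = exp (llr ch o1) * (u w true / u w false)).
      { replace (alstar w ch + X alstar ch o1) with (llr ch o1 + ln (u w true / u w false))
          by (unfold llr, alstar; ring).
        rewrite exp_plus, exp_ln; [reflexivity|]. now apply Rdiv_lt_0_compat. }
      pose proof (exp_pos (llr ch o1)) as Hc. pose proof q_gt1 as Hq.
      unfold fmsg. rewrite exp_ln.
      * rewrite Hz. set (z := exp (llr ch o1)) in *.
        unfold pk, Sp in *. rewrite exp_spin_pp, exp_spin_pm, exp_spin_mp, exp_spin_mm, exp_double in *.
        set (e := exp beta) in *. set (x := u w true) in *. set (y := u w false) in *.
        assert (0 < x * z) by nra. assert (0 < e * e) by nra.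
        assert (0 < e * e * y) by nra. assert (0 < e * e * x) by nra.
        field. repeat split; try lra.
      * pose proof (exp_pos (alstar w ch + X alstar ch o1)).
        apply Rdiv_lt_0_compat; nra.
Qed.

(** Effective conductance from the common parent to the leaves when edges at depth [k] have
    conductance [t^(2k)]: siblings are in parallel, and [C / (1 + C)] is a unit resistor in series
    with conductance [C]. *)
Fixpoint condF (t : R) (F : forest) : R :=
  match F with
  | Nil => 0
  | Cons w ch sib =>
      t ^ 2 * match ch with Nil => 1 | _ => condF t ch / (1 + condF t ch) end
      + condF t sib
  end.

Lemma condF_ge0 t F : 0 <= condF t F.
Proof.
  induction F as [|w ch IHc sib IHs]; simpl; [lra|].
  apply Rplus_le_le_0_compat; [|assumption]. apply Rmult_le_pos; [nra|].
  destruct ch; [lra|]. apply Rle_mult_inv_pos; lra.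
Qed.

Lemma condF_pos t w ch sib : 0 < t -> 0 < condF t (Cons w ch sib).
Proof.
  intros Ht. revert w sib; induction ch as [|w' ch' IHc sib' IHs]; intros w sib;
    pose proof (condF_ge0 t sib) as Hs.
  - simpl. nra.
  - specialize (IHc w' sib'). cbn [condF] in *.
    apply Rplus_lt_le_0_compat; [|assumption]. apply Rmult_lt_0_compat; [nra|].
    apply Rdiv_lt_0_compat; lra.
Qed.

(** Amounts to [|tanh (L / 2)| <= |L|], and follows from [exp L >= 1 + L] and
    [exp (- L) >= 1 - L]. *)
Lemma exp_sub1_sqr_le (L : R) : (exp L - 1) ^ 2 <= (exp L - 1) * L * (exp L + 1).
Proof.
  pose proof (exp_pos L) as Hz. pose proof (exp_ineq1_le L) as H1.
  pose proof (exp_ineq1_le (- L)) as H2. rewrite exp_Ropp in H2.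
  set (z := exp L) in *.
  assert (H3 : (1 - L) * z <= 1).
  { apply Rmult_le_compat_r with (r := z) in H2; [|lra].
    rewrite Rinv_l in H2 by lra. lra. }
  destruct (Rle_dec 0 L) as [HL|HL].
  - assert (0 <= z - 1) by lra. assert (z - 1 <= L * (z + 1)) by nra. nra.
  - assert (z <= 1).
    { assert (0 < 1 - L) by lra. nra. }
    assert (0 <= 1 - z) by lra. assert (1 - z <= - L * (z + 1)) by nra. nra.
Qed.

(** With [L] the log-likelihood ratio, averaging over the law under spin [-] turns the left side
    into an L1 distance, [(exp L - 1) * L] into the symmetrised relative entropy, and [exp L + 1]
    into 2. *)
Lemma abs_exp_sub1_le (L t : R) : 0 < t ->
  Rabs (exp L - 1) <= ((exp L - 1) * L / t + t * (exp L + 1)) / 2.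
Proof.
  intros Ht. pose proof (exp_sub1_sqr_le L) as H1. pose proof (exp_pos L) as Hz.
  set (z := exp L) in *. set (a := Rabs (z - 1)).
  assert (Ha : a ^ 2 = (z - 1) ^ 2) by (unfold a; now rewrite pow2_abs).
  set (m := (z - 1) * L) in *.
  apply Rmult_le_reg_r with (2 * t * (z + 1)); [nra|].
  replace ((m / t + t * (z + 1)) / 2 * (2 * t * (z + 1)))
    with (m * (z + 1) + t ^ 2 * (z + 1) ^ 2) by (field; lra).
  assert (0 <= (a - t * (z + 1)) ^ 2) by apply pow2_ge_0.
  nra.
Qed.

(* Total variation bound: AM-GM against the symmetrised relative entropy. *)
Lemma Ex_tv F M c psi : posF F -> 0 < M -> 0 <= c ->
  E F true (X alstar F) - E F false (X alstar F) <= M ->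
  (forall o, Rabs (psi o) <= c) ->
  E F true psi - E F false psi <= c * sqrt (2 * M).
Proof.
  intros Hpos HM Hc HJ Hpsi.
  (* The value [sqrt (M / 2)] balances the two terms [c M / (2 t)] and [c t] of the final bound. *)
  set (t := sqrt (2 * M) / 2).
  assert (Hs : 0 < sqrt (2 * M)) by (apply sqrt_lt_R0; lra).
  assert (Ht : 0 < t) by (unfold t; lra).
  assert (Hsq : sqrt (2 * M) * sqrt (2 * M) = 2 * M) by (apply sqrt_sqrt; lra).
  set (m := E F true (llr F) - E F false (llr F)).
  assert (Hm : m <= M).
  { assert (Hl : forall a, E F a (llr F) = E F a (X alstar F) + - kF F).
    { intros a. rewrite <- (Ex_const pk F a (- kF F) pk_markov) at 1. now rewrite <- Ex_plus. }
    unfold m. rewrite !Hl. lra. }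
  (* A change of measure exhibits [m] as the symmetrised relative entropy. *)
  assert (HmE : m = E F false (fun o => (exp (llr F o) - 1) * llr F o)).
  { unfold m. rewrite (Ex_llr F (llr F)) by assumption.
    replace (E F false (llr F)) with (- (E F false (fun o => (-1) * llr F o)))
      by (rewrite Ex_scal; ring).
    rewrite Rminus_def, Ropp_involutive, <- Ex_plus. apply Ex_ext. intros o. ring. }
  assert (H1 : E F false (fun o => exp (llr F o)) = 1).
  { rewrite <- (Ex_const pk F true 1 pk_markov), (Ex_llr F (fun _ => 1)) by assumption.
    apply Ex_ext. intros o. ring. }
  replace (E F true psi - E F false psi)
    with (E F false (fun o => (exp (llr F o) - 1) * psi o)).
  2:{ rewrite (Ex_llr F psi) by assumption.
      replace (E F false psi) with (- (E F false (fun o => (-1) * psi o)))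
        by (rewrite Ex_scal; ring).
      rewrite Rminus_def, Ropp_involutive, <- Ex_plus. apply Ex_ext. intros o. ring. }
  apply Rle_trans with (E F false (fun o =>
    (c / (2 * t)) * ((exp (llr F o) - 1) * llr F o) + ((c * t / 2) * exp (llr F o) + c * t / 2))).
  - apply Ex_le. intros o.
    pose proof (abs_exp_sub1_le (llr F o) t Ht) as Ha.
    apply Rle_trans with (Rabs (exp (llr F o) - 1) * c).
    + eapply Rle_trans; [apply Rle_abs|]. rewrite Rabs_mult.
      apply Rmult_le_compat_l; [apply Rabs_pos|apply Hpsi].
    + apply Rmult_le_compat_r with (r := c) in Ha; [|assumption].
      eapply Rle_trans; [apply Ha|]. right. field. lra.
  - rewrite !Ex_plus, !Ex_scal, Ex_const by apply pk_markov. rewrite H1, <- HmE.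
    replace (c * sqrt (2 * M)) with (c / (2 * t) * M + (c * t / 2 * 1 + c * t / 2)).
    + apply Rplus_le_compat_r. apply Rmult_le_compat_l; [|assumption].
      apply Rle_mult_inv_pos; lra.
    + replace M with (sqrt (2 * M) * sqrt (2 * M) / 2) at 1 by lra.
      unfold t. field. lra.
Qed.

(** The regime [N < 2] of [saturation] asks for [kappa0 * (2 + 1/8) <= 1/32], so [kappa0 <= 1/68];
    the theorem wants more than [1/100]. *)
Definition kappa0 : R := 1 / 80.
Let kp := kappa0 * (1 - th) / 4.

Lemma kappa_factor_pos : 0 < kp.
Proof. pose proof theta_bounds. unfold kp, kappa0. lra. Qed.

(** Since [th / (1 - th) = (q - 1) / 2], this is [2 beta <= exp (2 beta) - 1]. *)
Lemma four_beta_le : 4 * beta <= 4 * th / (1 - th).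
Proof.
  pose proof q_gt1 as Hq. unfold th, theta_of.
  replace (4 * ((q - 1) / (q + 1)) / (1 - (q - 1) / (q + 1))) with (2 * (q - 1)) by (field; lra).
  pose proof (exp_ineq1_le (2 * beta)) as He. fold q in He. lra.
Qed.

(** Merges a bound uniform in [M], good for large [M], with the slope gain, good for small [M], into
    one series-law bound. *)
Lemma saturation (M D : R) : 0 < M ->
  D <= 4 * th / (1 - th) -> D <= (th + slope q (M / 32)) * M / 2 ->
  D <= th * (M / (1 + kp * M)).
Proof.
  intros HM D1 D2. pose proof theta_bounds as Ht. pose proof q_gt1 as Hq.
  pose proof kappa_factor_pos as Hk.
  (* Makes [slope q (M / 32)] equal to [th / (1 + v)]; also [v = (1 + th) N / 32] for the [N] below,
     so [v] is at least [N / 32], and at most [1/8] when [N < 2]. *)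
  set (v := (1 - th ^ 2) * M / 128).
  assert (Hv : 0 < v).
  { unfold v. assert (0 < 1 - th ^ 2) by nra. nra. }
  assert (Hsl : slope q (M / 32) = th / (1 + v)).
  { unfold v, th, slope, theta_of. field. repeat split; try nra. }
  rewrite Hsl in D2.
  assert (HkM : 0 < 1 + kp * M) by nra.
  set (N := (1 - th) * M / 4).
  assert (HkN : kp * M = kappa0 * N) by (unfold kp, N; field).
  destruct (Rle_dec 2 N) as [HN|HN].
  - eapply Rle_trans; [apply D1|].
    apply Rmult_le_reg_r with ((1 - th) * (1 + kp * M)); [nra|].
    replace (4 * th / (1 - th) * ((1 - th) * (1 + kp * M))) with (4 * th * (1 + kp * M)) by (field; lra).
    replace (th * (M / (1 + kp * M)) * ((1 - th) * (1 + kp * M)))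
      with (4 * th * N) by (unfold N; field; lra).
    apply Rmult_le_compat_l; [lra|]. rewrite HkN. unfold kappa0. lra.
  - eapply Rle_trans; [apply D2|].
    replace ((th + th / (1 + v)) * M / 2) with (th * M * ((2 + v) / (2 * (1 + v)))) by (field; lra).
    replace (th * (M / (1 + kp * M))) with (th * M * / (1 + kp * M)) by (field; lra).
    apply Rmult_le_compat_l; [nra|].
    apply Rmult_le_reg_r with (2 * (1 + v) * (1 + kp * M)); [nra|].
    replace ((2 + v) / (2 * (1 + v)) * (2 * (1 + v) * (1 + kp * M))) with ((2 + v) * (1 + kp * M)) by (field; lra).
    replace (/ (1 + kp * M) * (2 * (1 + v) * (1 + kp * M))) with (2 * (1 + v)) by (field; lra).
    rewrite HkN. assert (Hv' : v = (1 + th) * N / 32) by (unfold v, N; field).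
    assert (0 < N) by (unfold N; nra).
    assert (v <= 1 / 8) by (rewrite Hv'; nra).
    assert (kappa0 * N * (2 + v) <= N / 32) by (unfold kappa0; nra).
    assert (N / 32 <= v) by (rewrite Hv'; nra).
    lra.
Qed.

(* Split [fmsg] as a linear function plus a bounded one minus a monotone one: the
   first is controlled by [M], the second by total variation, and the third by
   the stochastic domination [Ex_mono]. *)
Lemma Ex_fmsg_le F (al : R) (a : nat -> forest -> R) M : posF F -> 0 < M ->
  (forall a', E F true (X a' F) - E F false (X a' F) <= M) ->
  0 <= E F true (fun o => fmsg q (al + X a F o)) - E F false (fun o => fmsg q (al + X a F o))
    <= th * (M / (1 + kp * M)).
Proof.
  intros Hpos HM HX. pose proof q_gt1 as Hq. pose proof theta_bounds as Hth. split.
  - assert (Hm : omono (fun o => fmsg q (al + X a F o))).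
    { intros o o' Ho. apply fmsg_mono. apply Rplus_le_compat_l. now apply X_mono. }
    pose proof (Ex_mono F _ Hm). lra.
  - assert (Hs : 0 < sqrt (2 * M)) by (apply sqrt_lt_R0; lra).
    assert (Hsq : sqrt (2 * M) * sqrt (2 * M) = 2 * M) by (apply sqrt_sqrt; lra).
    apply saturation; [assumption| |].
    + eapply Rle_trans; [|apply four_beta_le].
      assert (E F true (fun o => fmsg q (al + X a F o)) <= 2 * beta).
      { rewrite <- (Ex_const pk F true (2 * beta)) by apply pk_markov. apply Ex_le.
        intros o. now apply fmsg_bound. }
      assert (- (2 * beta) <= E F false (fun o => fmsg q (al + X a F o))).
      { rewrite <- (Ex_const pk F false (- (2 * beta))) by apply pk_markov. apply Ex_le.
        intros o. now apply fmsg_bound. }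
      lra.
    + set (c := sqrt (2 * M) / 4).
      assert (Hc : 0 <= c) by (unfold c; lra).
      assert (Hc2 : c ^ 2 / 4 = M / 32) by (unfold c; nra).
      set (l := slope q (M / 32)).
      assert (Hl : l <= th).
      { unfold l, th. rewrite <- slope_0 by assumption. unfold slope, Rdiv.
        apply Rmult_le_compat_l; [nra|]. apply Rinv_le_contravar; nra. }
      set (psi1 := fun o => clamp c (al + X a F o)).
      set (psi2 := fun o => l * X a F o + (th - l) * psi1 o + (-1) * fmsg q (al + X a F o)).
      assert (Hm : omono psi2).
      { intros o o' Ho. pose proof (X_mono a F o o' Ho) as Hx. unfold psi2, psi1.
        pose proof (fmsg_clamp_increment q c (al + X a F o) (al + X a F o') Hq Hc ltac:(lra)) as Hi.
        rewrite Hc2 in Hi. fold l th in Hi. lra. }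
      pose proof (Ex_mono F _ Hm) as H2. unfold psi2 in H2.
      rewrite !Ex_plus, !Ex_scal in H2.
      assert (H1 : E F true psi1 - E F false psi1 <= c * sqrt (2 * M)).
      { apply Ex_tv; auto. intros o. unfold psi1, clamp.
        apply Rabs_le. unfold Rmax, Rmin.
        repeat match goal with |- context [Rle_dec ?x ?y] => destruct (Rle_dec x y) end; lra. }
      assert (H3 : c * sqrt (2 * M) = M / 2) by (unfold c; lra).
      rewrite H3 in H1. specialize (HX a).
      assert (Hl0 : 0 <= l).
      { unfold l, slope. apply Rle_mult_inv_pos; nra. }
      assert (l * (E F true (X a F) - E F false (X a F)) <= l * M) by nra.
      assert ((th - l) * (E F true psi1 - E F false psi1) <= (th - l) * (M / 2)) by nra.
      lra.
Qed.

(** Siblings add up, and each root [w] contributes its influence, at most [th], times the gap of its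
    message. The induction is uniform in [al], because the total variation bound needs the case
    [alstar] even for other shifts. *)
Theorem Ex_X_le F (al : nat -> forest -> R) : posF F ->
  E F true (X al F) - E F false (X al F) <= condF th F / kp.
Proof.
  pose proof kappa_factor_pos as Hk. pose proof theta_bounds as Hth.
  revert al; induction F as [|w ch IHc sib IHs]; intros al Hpos.
  - simpl. unfold Rdiv. lra.
  - destruct Hpos as (_ & Pc & Ps). specialize (IHs al Ps).
    assert (Step : forall y : bool -> out -> R,
      (forall b o1 o2, X al (Cons w ch sib) (OCons (lab ch b) o1 o2) = y b o1 + X al sib o2) ->
      E (Cons w ch sib) true (X al (Cons w ch sib)) - E (Cons w ch sib) false (X al (Cons w ch sib)) =
      (pk w true true - pk w false true) * (E ch true (y true) - E ch false (y false)) +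
      (E sib true (X al sib) - E sib false (X al sib))).
    { intros y Hy.
      assert (HE : forall a b, E ch b (fun o1 => E sib a (fun o2 => X al (Cons w ch sib) (OCons (lab ch b) o1 o2)))
        = E ch b (y b) + E sib a (X al sib)).
      { intros a b. rewrite <- (Ex_const pk ch b (E sib a (X al sib)) pk_markov) at 1.
        rewrite <- Ex_plus. apply Ex_ext. intros o1.
        rewrite <- (Ex_const pk sib a (y b o1) pk_markov), <- Ex_plus.
        apply Ex_ext. intros o2. apply Hy. }
      cbn [Ex]. rewrite !HE.
      pose proof (pk_markov w true). pose proof (pk_markov w false).
      assert (pk w false false = 1 - pk w false true) as -> by lra.
      assert (pk w true false = 1 - pk w true true) as -> by lra.
      ring. }
    destruct (pk_influence w) as [I1 I2].
    destruct ch as [|w' ch' sib'].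
    + rewrite (Step (fun b _ => 2 * beta * spin b)) by reflexivity. simpl Ex at 1 2.
      replace (condF th (Cons w Nil sib) / kp) with (th * (th / kp) + condF th sib / kp)
        by (simpl; field; lra).
      apply Rplus_le_compat; [|assumption].
      assert (H4 : 4 * beta <= th / kp).
      { eapply Rle_trans; [apply four_beta_le|]. unfold kp, kappa0.
        replace (th / (1 / 80 * (1 - th) / 4)) with (80 * (4 * th / (1 - th))) by (field; lra).
        assert (0 < 4 * th / (1 - th)) by (apply Rdiv_lt_0_compat; lra). lra. }
      unfold spin. nra.
    + set (ch := Cons w' ch' sib') in *.
      rewrite (Step (fun _ o1 => fmsg q (al w ch + X al ch o1))) by reflexivity.
      pose proof (condF_pos th w' ch' sib' (proj1 Hth)) as HC. fold ch in HC.
      destruct (Ex_fmsg_le ch (al w ch) al (condF th ch / kp)) as [F1 F2]; auto.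
      { now apply Rdiv_lt_0_compat. }
      (* For [M = C / kp] the bound [M / (1 + kp * M)] is [C / (1 + C) / kp]; one factor [th] comes
         from the influence, the other from [Ex_fmsg_le]. *)
      replace (condF th (Cons w ch sib) / kp) with
        (th * (th * (condF th ch / kp / (1 + kp * (condF th ch / kp)))) + condF th sib / kp).
      2:{ unfold ch at 3. cbn [condF]. fold ch.
          change (th ^ 2 * match ch' with Nil => 1 | Cons _ _ _ => condF th ch' / (1 + condF th ch') end + condF th sib')
            with (condF th ch). field. split; lra. }
      apply Rplus_le_compat; [|assumption].
      apply Rmult_le_compat; assumption.
Qed.

End Chain.

(** * The forest of a labelled tree *)

(* Vertices are attached in decreasing order, so that the children of [w] are
   complete when [w] itself is attached to its parent. *)
Fixpoint grow (par : nat -> nat) (l : list nat) : nat -> forest :=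
  match l with
  | [] => fun _ => Nil
  | w :: l' => fun v =>
      if Nat.eqb v (par w) then Cons w (grow par l' w) (grow par l' v)
      else grow par l' v
  end.

Definition sub (n : nat) (par : nat -> nat) : nat -> forest :=
  grow par (seq 1 (n - 1)).

Definition forest_of (S : nat -> forest) (l : list nat) : forest :=
  fold_right (fun w acc => Cons w (S w) acc) Nil l.

Section Sub.

Variables (n : nat) (par : nat -> nat).
Hypothesis Hpar : tree_ok n par.

(** The skipped vertices are at most [v], so their parents are smaller than [v] and they add no
    child to [v]. *)
Lemma grow_stable v j k m : (1 <= j)%nat -> (j + k + m <= n)%nat -> (j + k <= S v)%nat ->
  grow par (seq j (k + m)) v = grow par (seq (j + k) m) v.
Proof.
  revert j; induction k as [|k IH]; intros j Hj Hn Hv.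
  - now rewrite Nat.add_0_r.
  - simpl. assert (par j < j)%nat by (apply Hpar; lia).
    destruct (Nat.eqb_spec v (par j)); [lia|].
    rewrite IH by lia. f_equal. f_equal. lia.
Qed.

Lemma sub_children v :
  sub n par v = forest_of (sub n par) (filter (fun w => Nat.eqb (par w) v) (seq 1 (n - 1))).
Proof.
  assert (Hgen : forall m k, (k + m = n)%nat -> (1 <= k)%nat ->
    grow par (seq k m) v = forest_of (sub n par) (filter (fun w => Nat.eqb (par w) v) (seq k m))).
  { induction m as [|m IH]; intros k Hkm Hk; simpl; [reflexivity|].
    rewrite (Nat.eqb_sym v). destruct (Nat.eqb_spec (par k) v) as [E|E].
    - cbn [forest_of fold_right]. f_equal.
      + unfold sub. replace (n - 1)%nat with (k + m)%nat by lia.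
        rewrite (grow_stable k 1 k m) by lia. reflexivity.
      + apply IH; lia.
    - apply IH; lia. }
  destruct n as [|n'] eqn:En.
  - reflexivity.
  - apply Hgen; lia.
Qed.

Lemma flat_map_insert (h : nat -> list nat) (A : list nat) p l : NoDup l -> In p l ->
  Permutation (flat_map (fun v => if Nat.eqb v p then A ++ h v else h v) l) (A ++ flat_map h l).
Proof.
  induction l as [|v l IH]; intros Hnd Hp; [easy|].
  inversion Hnd as [|? ? Hv Hnd']; subst. simpl. destruct (Nat.eqb_spec v p) as [->|E].
  - rewrite <- app_assoc. apply Permutation_app_head, Permutation_app_head.
    rewrite !flat_map_concat_map, (map_ext_in _ h); auto. intros v Hvl.
    destruct (Nat.eqb_spec v p); congruence.
  - destruct Hp as [|Hp]; [congruence|]. rewrite (IH Hnd' Hp).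
    rewrite !app_assoc. apply Permutation_app_tail, Permutation_app_comm.
Qed.

Lemma dfs_sub : (1 <= n)%nat -> Permutation (dfs (sub n par 0%nat)) (seq 1 (n - 1)).
Proof.
  intros Hn.
  (* Invariant: once [k, ..., n-1] are attached, the forests hanging from [0, ..., k-1] list them
     exactly once between them; the claim is [k = 1]. *)
  assert (Hgen : forall m k, (k + m = n)%nat -> (1 <= k)%nat ->
    Permutation (flat_map (fun v => dfs (grow par (seq k m) v)) (seq 0 k)) (seq k m)).
  { induction m as [|m IH]; intros k Hkm Hk.
    - simpl. induction (seq 0 k) as [|? ? IHl]; simpl; auto.
    - specialize (IH (S k) ltac:(lia) ltac:(lia)).
      rewrite seq_S, flat_map_app in IH. simpl in IH. rewrite app_nil_r in IH.
      assert (par k < k)%nat by (apply Hpar; lia).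
      set (g := grow par (seq (S k) m)) in *.
      rewrite (flat_map_ext _ (fun v => if Nat.eqb v (par k) then (k :: dfs (g k)) ++ dfs (g v) else dfs (g v))).
      + rewrite (flat_map_insert (fun v => dfs (g v))).
        * simpl. constructor. rewrite <- IH. apply Permutation_app_comm.
        * apply seq_NoDup.
        * apply in_seq. lia.
      + intros v. simpl. fold g. destruct (Nat.eqb v (par k)); reflexivity. }
  specialize (Hgen (n - 1)%nat 1%nat ltac:(lia) ltac:(lia)).
  simpl in Hgen. now rewrite app_nil_r in Hgen.
Qed.

(** The clause on [ch] ties a node to its label, so that [doob], which is indexed by labels, uses
    the partition function of the actual subtree. *)
Fixpoint wf (v : nat) (F : forest) : Prop :=
  match F with
  | Nil => True
  | Cons w ch sib =>
      (par w = v /\ (1 <= w < n)%nat /\ ch = sub n par w) /\ wf w ch /\ wf v sib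
  end.

Lemma wf_sub v : wf v (sub n par v).
Proof.
  assert (Hgen : forall k v, (n - v <= k)%nat -> wf v (sub n par v)).
  { clear v. induction k as [|k IH]; intros v Hv.
    - rewrite sub_children.
      assert (Hl : forall w, In w (filter (fun w => Nat.eqb (par w) v) (seq 1 (n - 1))) -> False).
      { intros w Hw. apply filter_In in Hw. destruct Hw as [Hw E]. apply in_seq in Hw.
        apply Nat.eqb_eq in E. assert (par w < w)%nat by (apply Hpar; lia). lia. }
      destruct (filter _ _) as [|w l]; [exact I|]. exfalso. apply (Hl w). now left.
    - rewrite sub_children.
      assert (Hl : forall w, In w (filter (fun w => Nat.eqb (par w) v) (seq 1 (n - 1))) ->
        par w = v /\ (1 <= w < n)%nat).
      { intros w Hw. apply filter_In in Hw. destruct Hw as [Hw E]. apply in_seq in Hw.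
        apply Nat.eqb_eq in E. lia. }
      induction (filter _ _) as [|w l IHl]; [exact I|].
      destruct (Hl w) as [E Hw]; [now left|].
      assert (par w < w)%nat by (apply Hpar; lia).
      cbn [forest_of fold_right wf]. repeat split; try lia.
      + apply IH. lia.
      + apply IHl. intros w' Hw'. apply Hl. now right. }
  now apply (Hgen (n - v)%nat).
Qed.

(** The part of [wf] that survives pruning. *)
Fixpoint rooted (v : nat) (F : forest) : Prop :=
  match F with
  | Nil => True
  | Cons w ch sib => par w = v /\ rooted w ch /\ rooted v sib
  end.

Lemma rooted_prune H v F : wf v F -> rooted v (prune H F).
Proof.
  revert v; induction F as [|w ch IHc sib IHs]; intros v; simpl; [auto|].
  intros ((E & _ & _) & Hc & Hs). destruct (H w); simpl; auto.
Qed.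

Lemma rooted_wf v F : wf v F -> rooted v F.
Proof.
  revert v; induction F as [|w ch IHc sib IHs]; intros v; simpl; [auto|].
  intros ((E & _ & _) & Hc & Hs). auto.
Qed.

Lemma prodl_wt K v F s : rooted v F ->
  wt K F (s v) s = prodl (fun w => K w (s (par w)) (s w)) (dfs F).
Proof.
  revert v; induction F as [|w ch IHc sib IHs]; intros v Hr; simpl; [reflexivity|].
  destruct Hr as (E & Hc & Hs).
  rewrite prodl_cons, prodl_app, <- (IHc w Hc), <- (IHs v Hs), E. ring.
Qed.

(** Doob transform of [K] by the partition functions below each vertex, which turns Gibbs weights
    into transition probabilities. *)
Definition doob (K : nat -> bool -> bool -> R) (w : nat) (a b : bool) : R :=
  K w a b * Zf K (sub n par w) b /
  (K w a true * Zf K (sub n par w) true + K w a false * Zf K (sub n par w) false).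

(** The normalisers telescope: each [Zf] of a subtree cancels against the step into its root,
    leaving only the partition function at the top. *)
Lemma wt_doob K v F a s : wf v F ->
  (forall w a, K w a true * Zf K (sub n par w) true + K w a false * Zf K (sub n par w) false <> 0) ->
  wt K F a s = Zf K F a * wt (doob K) F a s.
Proof.
  intros Hwf HK. revert v a Hwf; induction F as [|w ch IHc sib IHs]; intros v a Hwf; simpl; [ring|].
  destruct Hwf as ((_ & _ & E) & Hc & Hs).
  rewrite (IHc w _ Hc), (IHs v _ Hs). unfold doob at 3. rewrite E in *.
  field. apply HK.
Qed.

Variable (H : nat -> bool).
Hypothesis HH : hat_subtree n par H.

Lemma prune_forest_of l :
  prune H (forest_of (sub n par) l) = forest_of (fun w => prune H (sub n par w)) (filter H l).
Proof.
  induction l as [|w l IH]; simpl; [reflexivity|].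
  destruct (H w); simpl; now rewrite IH.
Qed.

Lemma prune_sub_children v :
  prune H (sub n par v) = forest_of (fun w => prune H (sub n par w)) (childrenH n par H v).
Proof.
  rewrite sub_children, prune_forest_of. f_equal. unfold childrenH, edgesH.
  induction (seq 1 (n - 1)) as [|w l IH]; simpl; [reflexivity|].
  destruct (H w) eqn:Hw; destruct (Nat.eqb (par w) v) eqn:Ev; simpl; rewrite ?Hw, ?Ev, IH; reflexivity.
Qed.

Lemma leafH_children v : H v = true -> (0 < v)%nat ->
  leafH n par H v = match childrenH n par H v with [] => true | _ => false end.
Proof.
  intros Hv H0. unfold leafH, childrenH, edgesH. rewrite Hv.
  destruct (Nat.eqb_spec v 0); [lia|]. simpl.
  induction (seq 1 (n - 1)) as [|w l IH]; simpl; [reflexivity|].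
  destruct (H w) eqn:Hw; simpl; [|assumption].
  destruct (Nat.eqb (par w) v); simpl; [reflexivity|assumption].
Qed.

Lemma leafH_prune v : H v = true -> (0 < v)%nat ->
  leafH n par H v = match prune H (sub n par v) with Nil => true | _ => false end.
Proof.
  intros Hv H0. rewrite leafH_children, prune_sub_children by assumption.
  destruct (childrenH n par H v); reflexivity.
Qed.

Lemma dfs_prune v F : wf v F ->
  Permutation (dfs (prune H F)) (filter H (dfs F)).
Proof.
  destruct HH as (_ & _ & Hup).
  (* [H] is closed under parents, so cutting the whole subtree below a vertex outside [H] loses no
     vertex of [H]. *)
  assert (Hnone : forall F v, wf v F -> H v = false -> filter H (dfs F) = []).
  { clear F v. induction F as [|w ch IHc sib IHs]; intros v Hwf Hv; simpl; [reflexivity|].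
    destruct Hwf as ((E & Hw & _) & Hc & Hs).
    assert (Hf : H w = false).
    { destruct (H w) eqn:Ew; auto. apply Hup in Ew; [|lia]. congruence. }
    rewrite Hf, filter_app, (IHc w), (IHs v); auto. }
  revert v; induction F as [|w ch IHc sib IHs]; intros v Hwf; simpl; [constructor|].
  destruct Hwf as ((E & Hw & _) & Hc & Hs).
  rewrite filter_app. destruct (H w) eqn:Ew; simpl.
  - constructor. apply Permutation_app; eauto.
  - rewrite (Hnone ch w Hc Ew). simpl. eauto.
Qed.

End Sub.

(** * The current flow *)

Lemma sumR_scal (c : R) (h : nat -> R) (l : list nat) :
  fold_right Rplus 0 (map (fun w => c * h w) l) = c * fold_right Rplus 0 (map h l).
Proof. induction l as [|w l IH]; simpl; [ring|]. rewrite IH. ring. Qed.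

Section Paths.

Variables (n : nat) (par : nat -> nat).
Hypothesis Hpar : tree_ok n par.

Lemma ancs_fuel k w : (w <= k)%nat -> (w < n)%nat -> ancs par (S k) w = ancs par k w.
Proof.
  revert w; induction k as [|k IH]; intros w Hk Hn.
  - assert (w = 0)%nat by lia. subst. reflexivity.
  - change (ancs par (S (S k)) w) with (if Nat.eqb w 0 then [0%nat] else w :: ancs par (S k) (par w)).
    change (ancs par (S k) w) with (if Nat.eqb w 0 then [0%nat] else w :: ancs par k (par w)).
    destruct (Nat.eqb_spec w 0); [reflexivity|].
    assert (par w < w)%nat by (apply Hpar; lia). rewrite IH by lia. reflexivity.
Qed.

Lemma path_0 : (0 < n)%nat -> path_to_root n par 0 = [0%nat].
Proof. intros Hn. unfold path_to_root. now replace n with (S (n - 1)) by lia. Qed.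

Lemma path_S w : (0 < w < n)%nat -> path_to_root n par w = w :: path_to_root n par (par w).
Proof.
  intros Hw. unfold path_to_root. assert (par w < w)%nat by (apply Hpar; lia).
  replace n with (S (n - 1)) by lia. rewrite (ancs_fuel (n - 1) (par w)) by lia.
  change (ancs par (S (n - 1)) w) with (if Nat.eqb w 0 then [0%nat] else w :: ancs par (n - 1) (par w)).
  destruct (Nat.eqb_spec w 0); [lia|reflexivity].
Qed.

Lemma dist_0 : (0 < n)%nat -> dist_root n par 0 = 0%nat.
Proof. intros Hn. unfold dist_root. now rewrite path_0. Qed.

Lemma dist_S w : (0 < w < n)%nat -> dist_root n par w = S (dist_root n par (par w)).
Proof.
  intros Hw. unfold dist_root. rewrite path_S by assumption. simpl.
  assert (par w < w)%nat by (apply Hpar; lia).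
  destruct (Nat.eq_dec (par w) 0) as [->|E].
  - rewrite path_0 by lia. reflexivity.
  - rewrite path_S by lia. reflexivity.
Qed.

End Paths.

Section Capacity.

Variables (n : nat) (par : nat -> nat) (H : nat -> bool) (t : R).
Hypothesis Hpar : tree_ok n par.
Hypothesis HH : hat_subtree n par H.
Hypothesis Ht : 0 < t.

Definition Cv (v : nat) : R := condF t (prune H (sub n par v)).

(** Voltage divider: the share of the parent's potential that drops across the edge above [w], all
    of it at a leaf. *)
Definition rv (w : nat) : R := if leafH n par H w then 1 else Cv w / (1 + Cv w).

Lemma Cv_ge0 v : 0 <= Cv v.
Proof. apply condF_ge0. Qed.

Lemma rv_bounds w : 0 <= rv w <= 1.
Proof.
  unfold rv. pose proof (Cv_ge0 w). destruct (leafH n par H w); [lra|]. split.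
  - apply Rle_mult_inv_pos; lra.
  - apply Rmult_le_reg_r with (1 + Cv w); [lra|]. unfold Rdiv.
    rewrite Rmult_assoc, Rinv_l by lra. lra.
Qed.

Lemma in_edgesH w : In w (edgesH n H) -> H w = true /\ (1 <= w < n)%nat.
Proof.
  unfold edgesH. rewrite filter_In, in_seq. intros [Hw ?]. split; [assumption|lia].
Qed.

Lemma in_childrenH v w : In w (childrenH n par H v) -> In w (edgesH n H) /\ par w = v.
Proof. unfold childrenH. rewrite filter_In. intros [Hw E]. now apply Nat.eqb_eq in E. Qed.

Lemma Cv_children v :
  Cv v = fold_right Rplus 0 (map (fun w => t ^ 2 * rv w) (childrenH n par H v)).
Proof.
  unfold Cv at 1. rewrite prune_sub_children by assumption.
  assert (Hl : forall w, In w (childrenH n par H v) -> H w = true /\ (0 < w)%nat).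
  { intros w Hw. apply in_childrenH in Hw. destruct Hw as [Hw _]. apply in_edgesH in Hw.
    split; [tauto|lia]. }
  induction (childrenH n par H v) as [|w l IH]; [reflexivity|].
  cbn [forest_of fold_right condF map]. fold (forest_of (fun w => prune H (sub n par w)) l).
  rewrite IH by (intros; apply Hl; now right). f_equal. f_equal.
  destruct (Hl w) as [Hw H0]; [now left|].
  unfold rv. rewrite leafH_prune by assumption. unfold Cv.
  destruct (prune H (sub n par w)); reflexivity.
Qed.

(* The potential of the unit-voltage current flow: 1 at the root, 0 at the
   leaves, and multiplied by [1 - rv w] across the edge above [w]. *)
Definition pot (w : nat) : R :=
  prodl (fun e => if Nat.eqb e 0 then 1 else 1 - rv e) (path_to_root n par w).

Lemma pot_0 : (0 < n)%nat -> pot 0 = 1.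
Proof. intros Hn. unfold pot. rewrite path_0 by assumption. unfold prodl. simpl. ring. Qed.

Lemma pot_S w : (0 < w < n)%nat -> pot w = (1 - rv w) * pot (par w).
Proof.
  intros Hw. unfold pot at 1. rewrite path_S, prodl_cons by assumption.
  destruct (Nat.eqb_spec w 0); [lia|]. reflexivity.
Qed.

Lemma pot_ge0 w : 0 <= pot w.
Proof.
  unfold pot. induction (path_to_root n par w) as [|e l IH].
  - unfold prodl; simpl; lra.
  - rewrite prodl_cons. apply Rmult_le_pos; [|assumption].
    destruct (Nat.eqb e 0); [lra|]. pose proof (rv_bounds e). lra.
Qed.

(** Ohm's law: the potential drop [pot (par w) * rv w] times the edge conductance [t^(2 dist w)]. *)
Definition current (w : nat) : R :=
  pot (par w) * t ^ (2 * dist_root n par (par w)) * (t ^ 2 * rv w).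

Lemma n_pos : (0 < n)%nat.
Proof. destruct HH as (H0 & Hlt & _). now apply Hlt. Qed.

Lemma current_children v :
  fold_right Rplus 0 (map current (childrenH n par H v)) =
  pot v * t ^ (2 * dist_root n par v) * Cv v.
Proof.
  rewrite Cv_children, <- sumR_scal. f_equal. apply map_ext_in. intros w Hw.
  apply in_childrenH in Hw. destruct Hw as [_ <-]. reflexivity.
Qed.

Lemma current_flow : is_flow n par H current.
Proof.
  split.
  - intros w Hw. unfold current. pose proof (pot_ge0 (par w)). pose proof (rv_bounds w).
    repeat apply Rmult_le_pos; try lra; try (left; apply pow_lt; lra).
  - intros w Hw Hl. apply in_edgesH in Hw. destruct Hw as [Hw Hn].
    (* Kirchhoff's node law reduces to [(1 - rv w) * Cv w = rv w]. *)
    rewrite current_children, pot_S, dist_S by (assumption || lia). unfold current.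
    pose proof (Cv_ge0 w).
    replace (2 * S (dist_root n par (par w)))%nat with (2 * dist_root n par (par w) + 2)%nat by lia.
    rewrite pow_add. unfold rv. rewrite Hl. field. lra.
Qed.

(** Current times resistance is the potential drop along an edge, so the sum telescopes. *)
Lemma current_path_sum w : (w < n)%nat ->
  path_sum n par (resist n par t) current w = 1 - pot w.
Proof.
  pose proof n_pos as Hn.
  induction w as [w IH] using (well_founded_induction lt_wf). intros Hw.
  destruct (Nat.eq_dec w 0) as [->|E].
  - unfold path_sum. rewrite path_0, pot_0 by assumption. simpl. ring.
  - assert (par w < w)%nat by (apply Hpar; lia).
    specialize (IH (par w) ltac:(lia) ltac:(lia)).
    unfold path_sum in *. rewrite path_S by (assumption || lia). cbn [filter].
    destruct (Nat.eqb_spec w 0) as [|_]; [lia|]. cbn [negb map fold_right].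
    rewrite IH, (pot_S w) by lia. unfold current, resist. rewrite (dist_S n par Hpar w) by lia.
    replace (2 * S (dist_root n par (par w)))%nat with (2 * dist_root n par (par w) + 2)%nat by lia.
    rewrite pow_add. pose proof (pow_lt t (2 * dist_root n par (par w)) Ht).
    field. split; lra.
Qed.

Lemma Cv_le_cap2 c : is_cap2 n par H (resist n par t) c -> Cv 0 <= c.
Proof.
  intros [Hub _]. apply Hub. exists current. repeat split.
  - apply current_flow.
  - apply current_flow.
  - unfold voltage.
    assert (Hl : forall w, In w (filter (leafH n par H) (verts n)) -> (w < n)%nat).
    { intros w Hw. apply filter_In in Hw. destruct Hw as [Hw _]. apply in_seq in Hw. lia. }
    induction (filter (leafH n par H) (verts n)) as [|w l IH]; simpl; [lra|].
    apply Rmax_lub.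
    + rewrite current_path_sum by (apply Hl; now left). pose proof (pot_ge0 w). lra.
    + apply IH. intros; apply Hl; now right.
  - unfold strength. pose proof n_pos. rewrite current_children, pot_0, dist_0 by assumption.
    simpl. ring.
Qed.

End Capacity.

(** * Gibbs measures as Markov chains *)

(** Pins make some kernel entries vanish; it suffices that each vertex has one spin allowed under
    both parent spins. *)
Lemma Zf_pos K F a : (forall w a b, 0 <= K w a b) ->
  (forall w, exists b, forall a, 0 < K w a b) -> 0 < Zf K F a.
Proof.
  intros K0 K1. revert a; induction F as [|w ch IHc sib IHs]; intros a; simpl; [lra|].
  apply Rmult_lt_0_compat; [|apply IHs].
  pose proof (IHc true). pose proof (IHc false).
  pose proof (K0 w a true). pose proof (K0 w a false).
  destruct (K1 w) as [b Hb]. specialize (Hb a). destruct b; nra.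
Qed.

Definition kern (beta : R) (fixed b : nat -> bool) (w : nat) (a c : bool) : R :=
  exp (beta * (spin a * spin c)) * (if fixed w then ind (Bool.eqb c (b w)) else 1).

Lemma Zf_kern_pos beta fixed b F a : 0 < Zf (kern beta fixed b) F a.
Proof.
  apply Zf_pos; unfold kern.
  - intros w a' c. apply Rmult_le_pos; [left; apply exp_pos|].
    unfold ind. destruct (fixed w); [destruct (Bool.eqb c (b w))|]; lra.
  - intros w. exists (b w). intros a'. rewrite eqb_reflx.
    pose proof (exp_pos (beta * (spin a' * spin (b w)))). unfold ind.
    destruct (fixed w); lra.
Qed.

Section Root.

Variables (n : nat) (par : nat -> nat) (beta : R).
Hypothesis Hpar : tree_ok n par.
Hypothesis Hn : (0 < n)%nat.

Lemma inT_root w : (w < n)%nat -> inT n par 0 w = true.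
Proof.
  intros Hw. unfold inT. apply andb_true_iff. split; [now apply Nat.ltb_lt|].
  revert Hw; induction w as [w IH] using (well_founded_induction lt_wf); intros Hw.
  destruct (Nat.eq_dec w 0) as [->|E].
  - rewrite path_0 by assumption. reflexivity.
  - assert (par w < w)%nat by (apply Hpar; lia).
    rewrite path_S by (assumption || lia). cbn [existsb].
    rewrite IH by lia. apply orb_true_r.
Qed.

Lemma verts_cons : verts n = 0%nat :: seq 1 (n - 1).
Proof. unfold verts. destruct n; [lia|]. simpl. now rewrite Nat.sub_0_r. Qed.

Lemma exp_energy P sg :
  exp (beta * energy n par P 0 sg) =
  prodl (fun w => exp (beta * (spin (sg (par w)) * spin (sg w)))) (filter P (seq 1 (n - 1))).
Proof.
  unfold energy.
  replace (filter (fun w => negb (Nat.eqb w 0) && inT n par 0 w && P w) (seq 1 (n - 1)))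
    with (filter P (seq 1 (n - 1))).
  - induction (filter P (seq 1 (n - 1))) as [|w l IH].
    + simpl. rewrite Rmult_0_r, exp_0. reflexivity.
    + rewrite prodl_cons, <- IH, <- exp_plus. f_equal. simpl. ring.
  - apply filter_ext_in. intros w Hw. apply in_seq in Hw.
    rewrite inT_root by lia. destruct (Nat.eqb_spec w 0); [lia|reflexivity].
Qed.

(** The indicator keeps one of the two root spins, [sumcfg_filter] moves the boundary condition into
    [kern], and the Boltzmann weight factors over edges. *)
Lemma gibbs_sum_root P fixed b FF s (h : (nat -> bool) -> R) :
  P 0%nat = true -> fixed 0%nat = false -> rooted par 0 FF ->
  Permutation (dfs FF) (filter P (seq 1 (n - 1))) ->
  sumcfg (filter (fun w => inT n par 0 w && P w && negb (fixed w)) (verts n)) b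
    (fun sg => exp (beta * energy n par P 0 sg) * (h sg * ind (Bool.eqb (sg 0%nat) s))) =
  sumcfg (dfs FF) (upd b 0 s) (fun sg => wt (kern beta fixed b) FF s sg * h sg).
Proof.
  intros HP Hf Hr Hperm.
  set (L := filter P (seq 1 (n - 1))) in *.
  assert (HndL : NoDup L) by (apply NoDup_filter, seq_NoDup).
  assert (HL0 : forall w, In w L -> w <> 0%nat).
  { intros w Hw ->. apply filter_In in Hw. destruct Hw as [Hw _]. apply in_seq in Hw. lia. }
  replace (filter (fun w => inT n par 0 w && P w && negb (fixed w)) (verts n))
    with (0%nat :: filter (fun w => negb (fixed w)) L).
  2:{ rewrite verts_cons. cbn [filter]. rewrite inT_root, HP, Hf by assumption.
      cbn [andb negb]. f_equal. unfold L.
      assert (Hs : forall w, In w (seq 1 (n - 1)) -> inT n par 0 w = true).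
      { intros w Hw. apply in_seq in Hw. apply inT_root. lia. }
      clear - Hs. induction (seq 1 (n - 1)) as [|w l IH]; [reflexivity|]. cbn [filter].
      rewrite (Hs w) by now left. rewrite <- IH by (intros; apply Hs; now right).
      destruct (P w); simpl; reflexivity. }
  cbn [sumcfg].
  assert (Hterm : forall c,
    sumcfg (filter (fun w => negb (fixed w)) L) (upd b 0 c)
      (fun sg => exp (beta * energy n par P 0 sg) * (h sg * ind (Bool.eqb (sg 0%nat) s))) =
    ind (Bool.eqb c s) * sumcfg (filter (fun w => negb (fixed w)) L) (upd b 0 c)
      (fun sg => exp (beta * energy n par P 0 sg) * h sg)).
  { intros c. rewrite <- sumcfg_scal. apply sumcfg_ext. intros sg Hsg.
    rewrite (Hsg 0%nat).
    - unfold upd at 1. simpl. ring.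
    - intros Hin. apply filter_In in Hin. destruct Hin as [Hin _]. now apply (HL0 0%nat). }
  rewrite !Hterm.
  transitivity (sumcfg (filter (fun w => negb (fixed w)) L) (upd b 0 s)
      (fun sg => exp (beta * energy n par P 0 sg) * h sg)).
  { destruct s; unfold ind; simpl; ring. }
  rewrite (sumcfg_filter L fixed b).
  - rewrite (sumcfg_perm (dfs FF) L); [|assumption|eapply Permutation_NoDup; [symmetry|]; eauto].
    apply sumcfg_ext. intros sg Hsg.
    assert (Es : sg 0%nat = s).
    { rewrite Hsg; [reflexivity|]. intros Hin. now apply (HL0 0%nat). }
    rewrite <- Es, (prodl_wt par) by assumption. rewrite (prodl_perm _ _ _ Hperm).
    rewrite exp_energy. fold L. unfold kern. rewrite prodl_mult. ring.
  - assumption.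
  - intros w Hw _. unfold upd. destruct (Nat.eqb_spec w 0); [|reflexivity].
    exfalso. now apply (HL0 w).
Qed.

Lemma gibbs_ratio P fixed b FF s s' (h : (nat -> bool) -> R) (f g : (nat -> bool) -> R) :
  P 0%nat = true -> fixed 0%nat = false -> rooted par 0 FF ->
  Permutation (dfs FF) (filter P (seq 1 (n - 1))) ->
  (forall sg, f sg = h sg * ind (Bool.eqb (sg 0%nat) s)) ->
  (forall sg, g sg = ind (Bool.eqb (sg 0%nat) s')) ->
  gibbs n par beta P fixed b 0 f / gibbs n par beta P fixed b 0 g =
  sumcfg (dfs FF) (upd b 0 s) (fun sg => wt (kern beta fixed b) FF s sg * h sg) /
  Zf (kern beta fixed b) FF s'.
Proof.
  intros HP Hf Hr Hperm Ef Eg. unfold gibbs.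
  assert (Hnd : NoDup (dfs FF)).
  { eapply Permutation_NoDup; [symmetry; eassumption|]. apply NoDup_filter, seq_NoDup. }
  rewrite <- (gibbs_sum_root P fixed b FF s h) by assumption.
  rewrite <- (sumcfg_wt _ FF s' (upd b 0 s') Hnd).
  pose proof (Zf_kern_pos beta fixed b FF s') as HZ.
  rewrite <- (sumcfg_wt _ FF s' (upd b 0 s') Hnd) in HZ.
  rewrite <- (gibbs_sum_root P fixed b FF s' (fun _ => 1)) in * by assumption.
  set (l := filter _ (verts n)) in *.
  rewrite (sumcfg_ext l b _ (fun sg => exp (beta * energy n par P 0 sg) * (h sg * ind (Bool.eqb (sg 0%nat) s))))
    by (intros; now rewrite Ef).
  rewrite (sumcfg_ext l b (fun sg => exp (beta * energy n par P 0 sg) * g sg)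
     (fun sg => exp (beta * energy n par P 0 sg) * (1 * ind (Bool.eqb (sg 0%nat) s'))))
    by (intros; rewrite Eg; ring).
  assert (HD : 0 < sumcfg l b (fun sg => exp (beta * energy n par P 0 sg)))
    by (apply sumcfg_pos; intros; apply exp_pos).
  field. lra.
Qed.

End Root.

(** * Log-ratios and boundary laws on the subtree hat T *)

Section Hat.

Variables (n : nat) (par : nat -> nat) (tau H : nat -> bool) (beta : R).
Hypothesis Hpar : tree_ok n par.
Hypothesis HH : hat_subtree n par H.
Hypothesis Hbeta : 0 < beta.

Let F := sub n par 0.
Let FH := prune H F.

Fixpoint leafok (F : forest) : Prop :=
  match F with
  | Nil => True
  | Cons w ch sib =>
      leafH n par H w = match ch with Nil => true | _ => false end /\ leafok ch /\ leafok sib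
  end.

Lemma leafok_prune v G : wf n par v G -> leafok (prune H G).
Proof.
  revert v; induction G as [|w ch IHc sib IHs]; intros v; simpl; [auto|].
  intros ((_ & Hw & E) & Hc & Hs). destruct (H w) eqn:EH; simpl; [|eauto].
  repeat split; eauto. rewrite E. apply leafH_prune; auto. lia.
Qed.

Lemma read_leaf G s s' : leafok G ->
  (forall w, In w (dfs G) -> leafH n par H w = true -> s w = s' w) -> read G s = read G s'.
Proof.
  induction G as [|w ch IHc sib IHs]; simpl; [reflexivity|].
  intros (El & Hc & Hs) Hl. f_equal.
  - destruct ch; simpl; [|reflexivity]. apply Hl; auto.
  - apply IHc; auto. intros u Hu. apply Hl. right. apply in_or_app. auto.
  - apply IHs; auto. intros u Hu. apply Hl. right. apply in_or_app. auto.
Qed.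

(** Belief propagation with zero field: a pinned leaf contributes [exp (2 * beta * spin)], and an
    inner vertex with log-ratio [x] below it contributes [(q exp x + 1) / (exp x + q)]. *)
Lemma Zf_X xi G : leafok G ->
  Zf (kern beta (leafH n par H) xi) G true =
  exp (X beta (fun _ _ => 0) G (read G xi)) * Zf (kern beta (leafH n par H) xi) G false.
Proof.
  set (K := kern beta (leafH n par H) xi).
  induction G as [|w ch IHc sib IHs]; intros Hl.
  - simpl. rewrite exp_0. ring.
  - destruct Hl as (El & Hc & Hs). specialize (IHc Hc). specialize (IHs Hs).
    pose proof (exp_pos beta) as He.
    cbn [Zf read X]. rewrite exp_plus, IHs. clear IHs.
    destruct ch as [|w' ch' sib'].
    + simpl Zf at 1 2 4 5. unfold lab.
      assert (Hr : forall a, K w a true * 1 + K w a false * 1 = exp (beta * (spin a * spin (xi w)))).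
      { intros a. unfold K, kern. rewrite El. destruct (xi w); unfold ind; simpl; ring. }
      rewrite !Hr.
      replace (exp (beta * (spin true * spin (xi w)))) with
        (exp (2 * beta * spin (xi w)) * exp (beta * (spin false * spin (xi w)))).
      * ring.
      * rewrite <- exp_plus. f_equal. simpl. ring.
    + set (ch := Cons w' ch' sib') in *.
      pose proof (Zf_kern_pos beta (leafH n par H) xi ch false) as HZ. fold K in HZ.
      assert (Hr : forall a b, K w a b = exp (beta * (spin a * spin b))).
      { intros a b. unfold K, kern. rewrite El. ring. }
      rewrite !Hr, IHc. rewrite Rplus_0_l.
      rewrite exp_spin_pp, exp_spin_mm, exp_spin_pm, exp_spin_mp.
      set (x := X beta (fun _ _ => 0) ch (read ch xi)). pose proof (exp_pos x) as Hx.
      unfold fmsg. rewrite exp_ln.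
      * assert (0 < exp beta * exp beta) by nra.
        rewrite exp_double. field. split; lra.
      * pose proof (exp_pos (2 * beta)). apply Rdiv_lt_0_compat; nra.
Qed.

Lemma hat_size_pos : (0 < n)%nat.
Proof. eapply n_pos; eauto. Qed.

Lemma perm_FH : Permutation (dfs FH) (filter H (seq 1 (n - 1))).
Proof.
  unfold FH, F. rewrite (dfs_prune n par H HH 0) by now apply wf_sub.
  apply filter_perm, dfs_sub; auto. pose proof hat_size_pos. lia.
Qed.

Lemma xv_X xi : xv n par beta H 0 xi = X beta (fun _ _ => 0) FH (read FH xi).
Proof.
  unfold xv, muH.
  assert (Hok : leafok FH) by (eapply leafok_prune; now apply wf_sub).
  assert (Hnd : NoDup (dfs FH)).
  { eapply Permutation_NoDup; [symmetry; apply perm_FH|]. apply NoDup_filter, seq_NoDup. }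
  rewrite (gibbs_ratio n par beta Hpar hat_size_pos H (leafH n par H) xi FH true false (fun _ => 1)).
  - rewrite sumcfg_wt by assumption. rewrite (Zf_X xi FH Hok).
    unfold Rdiv. rewrite Rmult_assoc, Rinv_r, Rmult_1_r, ln_exp; [reflexivity|].
    apply Rgt_not_eq, Zf_kern_pos.
  - apply HH.
  - unfold leafH. now rewrite Nat.eqb_refl, andb_false_r.
  - apply (rooted_prune n). now apply wf_sub.
  - apply perm_FH.
  - intros sg. destruct (sg 0%nat); unfold ind; simpl; ring.
  - intros sg. destruct (sg 0%nat); unfold ind; simpl; ring.
Qed.

Let K := kern beta (leafT n par) tau.

(** The weights [u] for which [pk] is the Gibbs chain on T: pin at [w] times the partition function
    below it. *)
Definition uT (w : nat) (b : bool) : R :=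
  (if leafT n par w then ind (Bool.eqb b (tau w)) else 1) *
  Zf (kern beta (leafT n par) tau) (sub n par w) b.

Lemma doob_pk : doob n par K = pk beta uT.
Proof.
  apply functional_extensionality; intros w.
  apply functional_extensionality; intros a.
  apply functional_extensionality; intros b.
  unfold doob, pk, Sp, uT, K, kern. now rewrite !Rmult_assoc.
Qed.

Lemma uT_nonneg w : 0 <= uT w true /\ 0 <= uT w false /\ 0 < uT w true + uT w false.
Proof.
  unfold uT. pose proof (Zf_kern_pos beta (leafT n par) tau (sub n par w) true).
  pose proof (Zf_kern_pos beta (leafT n par) tau (sub n par w) false).
  destruct (leafT n par w), (tau w); unfold ind; simpl; lra.
Qed.

(** Vertices of hat T are not leaves of T, hence are not pinned by [tau]. *)
Lemma posF_uT v G : wf n par v G -> posF uT (prune H G).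
Proof.
  revert v; induction G as [|w ch IHc sib IHs]; intros v; simpl; [auto|].
  intros ((_ & Hw & E) & Hc & Hs). destruct (H w) eqn:EH; simpl; [|eauto].
  repeat split; eauto; destruct HH as (_ & HT & _); destruct (HT w EH) as [_ HL];
    unfold uT; rewrite HL, Rmult_1_l; apply Zf_kern_pos.
Qed.

Lemma perm_F : Permutation (dfs F) (filter (fun _ => true) (seq 1 (n - 1))).
Proof.
  unfold F. rewrite dfs_sub; auto.
  - induction (seq 1 (n - 1)) as [|w l IH]; simpl; auto.
  - pose proof hat_size_pos. lia.
Qed.

Lemma Qv_chain s xi :
  Qv n par beta tau H 0 s xi =
  sumcfg (dfs F) (upd tau 0 s) (fun sg => wt (pk beta uT) F s sg *
    ind (forallb (fun w => Bool.eqb (sg w) (xi w)) (bdH_v n par H 0))).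
Proof.
  unfold Qv, muT.
  rewrite (gibbs_ratio n par beta Hpar hat_size_pos (fun _ => true) (leafT n par) tau F s s
    (fun sg => ind (forallb (fun w => Bool.eqb (sg w) (xi w)) (bdH_v n par H 0)))); auto.
  - fold K. pose proof (Zf_kern_pos beta (leafT n par) tau F s) as HZ. fold K in HZ.
    apply Rmult_eq_reg_l with (Zf K F s); [|lra].
    rewrite <- sumcfg_scal. unfold Rdiv. rewrite (Rmult_comm _ (/ _)), <- Rmult_assoc, Rinv_r, Rmult_1_l by lra.
    apply sumcfg_ext. intros sg _. rewrite <- doob_pk, <- Rmult_assoc. f_equal.
    apply (wt_doob n par K 0); [now apply wf_sub|].
    intros w a. pose proof (Sp_pos beta uT uT_nonneg w a) as HS.
    unfold Sp, uT in HS. unfold K, kern in *. rewrite !Rmult_assoc. lra.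
  - unfold leafT. rewrite Nat.eqb_refl. simpl. now rewrite andb_false_r.
  - apply (rooted_wf n). now apply wf_sub.
  - apply perm_F.
Qed.

(** Exchange the sums over boundary conditions and configurations; the indicator collapses the inner
    one to the leaf spins of [sg], and [sumcfg_Ex] marginalises onto hat T. *)
Lemma mean_chain s :
  sumcfg (bdH_v n par H 0) (fun _ => true)
    (fun xi => xv n par beta H 0 xi * Qv n par beta tau H 0 s xi) =
  Ex (pk beta uT) FH s (X beta (fun _ _ => 0) FH).
Proof.
  assert (Hnd : NoDup (dfs F)).
  { eapply Permutation_NoDup; [symmetry; apply perm_F|]. apply NoDup_filter, seq_NoDup. }
  rewrite <- (sumcfg_Ex (pk beta uT) H F s (upd tau 0 s) _ (pk_markov beta uT uT_nonneg) Hnd).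
  fold FH.
  rewrite (sumcfg_ext _ _ _ (fun xi => xv n par beta H 0 xi *
    sumcfg (dfs F) (upd tau 0 s) (fun sg => wt (pk beta uT) F s sg *
      ind (forallb (fun w => Bool.eqb (sg w) (xi w)) (bdH_v n par H 0)))))
    by (intros; now rewrite Qv_chain).
  rewrite sumcfg_swap. apply sumcfg_ext. intros sg _. f_equal.
  apply sumcfg_dirac.
  - apply NoDup_filter, seq_NoDup.
  - intros xi _ Hxi. rewrite xv_X. f_equal. apply read_leaf.
    + eapply leafok_prune; now apply wf_sub.
    + intros w Hw Hl. apply Hxi. apply filter_In.
      apply (Permutation_in _ perm_FH), filter_In in Hw. destruct Hw as [Hw _].
      apply in_seq in Hw. pose proof hat_size_pos. split; [apply in_seq; lia|].
      rewrite Hl, inT_root by (assumption || lia). reflexivity.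
Qed.

Lemma mv_le_Cv :
  mv n par beta tau H 0 <=
  Cv n par H (theta_of (exp (2 * beta))) 0 / (kappa0 * (1 - theta_of (exp (2 * beta))) / 4).
Proof.
  unfold mv. rewrite !mean_chain. apply Ex_X_le; auto using uT_nonneg.
  eapply posF_uT. now apply wf_sub.
Qed.

End Hat.

(** * Passage from [tanh beta] to [theta_of] and conclusion *)

Lemma tanh_eq_theta_of beta : tanh beta = theta_of (exp (2 * beta)).
Proof.
  unfold tanh, sinh, cosh, theta_of. rewrite exp_Ropp, (exp_double beta). pose proof (exp_pos beta).
  field. repeat split; nra.
Qed.

Lemma tanh_pos_inv beta : 0 < tanh beta -> 0 < beta.
Proof.
  intros Ht. apply Rnot_le_lt. intros Hb. rewrite tanh_eq_theta_of in Ht. unfold theta_of in Ht.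
  pose proof (exp_pos (2 * beta)) as Hq.
  assert (exp (2 * beta) <= 1).
  { rewrite <- exp_0. destruct Hb as [Hb|Hb]; [left; apply exp_increasing; lra|right; f_equal; lra]. }
  apply Rmult_lt_compat_r with (r := exp (2 * beta) + 1) in Ht; [|lra].
  unfold Rdiv in Ht. rewrite Rmult_assoc, Rinv_l in Ht by lra. lra.
Qed.

Theorem theorem3p2 :
  exists kappa : R, kappa > 1 / 100 /\
  forall (n : nat) (par : nat -> nat) (tau : nat -> bool) (H : nat -> bool)
         (beta : R),
    tree_ok n par ->
    hat_subtree n par H ->
    0 < tanh beta -> tanh beta <= 3 / 4 ->
    forall c : R, is_cap2 n par H (resist n par (tanh beta)) c ->
    mv n par beta tau H 0%nat <= c / (kappa * (1 - tanh beta) / 4).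
Proof.
  exists kappa0. split; [unfold kappa0; lra|].
  intros n par tau H beta Hpar HH Ht _ c Hc.
  pose proof (tanh_pos_inv beta Ht) as Hb.
  apply Rle_trans with (Cv n par H (tanh beta) 0 / (kappa0 * (1 - tanh beta) / 4)).
  - rewrite tanh_eq_theta_of. now apply mv_le_Cv.
  - pose proof (Cv_le_cap2 n par H (tanh beta) Hpar HH Ht c Hc) as HC.
    pose proof (kappa_factor_pos beta Hb) as Hk. rewrite <- tanh_eq_theta_of in Hk.
    apply Rmult_le_compat_r; [|assumption]. left. now apply Rinv_0_lt_compat.
Qed.
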